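(* Let $\Lambda\in P^+$ and $\beta=\alpha_{i_1}+\cdots+\alpha_{i_n}\in Q_n^+$ with $i_1,\dots,i_n\in I$ pairwise distinct. Then (the canonical image of) $$\Bigl\{\tau_wx^{\underline a}e(\nu)\ \Bigm|\ \nu\in I^\beta,\ w\in\mathfrak{S}_n,\ \underline a\in\mathbb{N}^n,\ a_t<\langle\alpha_{\nu_t}^\vee,\Lambda\rangle-\sum_{\substack{1\le k<t\\ w(k)<w(t)}}a_{\nu_t,\nu_k}\ \ \forall\,1\le t\le n\Bigr\}$$ is a $\mathbf{k}$-basis of $\mathscr{R}_\beta^\Lambda$. Moreover, the two-sided ideal $I_{\Lambda,\beta}$ has the $\mathbf{k}$-basis $$\Bigl\{\tau_wx^{\underline a}g^\Lambda_{w,\nu,k}e(\nu)\ \Bigm|\ \nu\in I^\beta,\ w\in\mathfrak{S}_n,\ 1\le k\le n,\ \underline a\in\mathbb{N}^n,\ a_t<\langle\alpha_{\nu_t}^\vee,\Lambda\rangle-\sum_{\substack{1\le l<t\\ w(l)<w(t)}}a_{\nu_t,\nu_l}\ \ \forall\,k<t\le n\Bigr\}.$$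
   Context: **Cartan datum.** $I$ is an index set and $A=(a_{ij})_{i,j\in I}$ is a symmetrizable generalized Cartan matrix (integral; $a_{ii}=2$; $a_{ij}\le 0$ for $i\ne j$; $a_{ij}=0\Leftrightarrow a_{ji}=0$; there are $d_i\in\mathbb{Z}_{>0}$ with $(d_ia_{ij})$ symmetric). In the claim, $a_{\nu_t,\nu_k}$ are Cartan matrix entries and $\underline a=(a_1,\dots,a_n)$ is an exponent vector. $P$ is a free abelian group of finite rank, $P^\vee=\mathrm{Hom}(P,\mathbb{Z})$ with pairing $\langle\cdot,\cdot\rangle$; linearly independent simple roots $\alpha_i\in P$ and simple coroots $\alpha_i^\vee\in P^\vee$ satisfy $\langle\alpha_i^\vee,\alpha_j\rangle=a_{ij}$, and there are fundamental weights $\Lambda_i\in P$ with $\langle\alpha_j^\vee,\Lambda_i\rangle=\delta_{ij}$. $P^+=\{\lambda\in P:\langle\alpha_i^\vee,\lambda\rangle\ge0\ \forall i\}$, $Q_n^+=\{\sum_ik_i\alpha_i:k_i\in\mathbb{Z}_{\ge0},\sum_ik_i=n\}$ ($n\ge1$ here), $(\alpha_i,\alpha_j)=d_ia_{ij}$. $\mathfrak{S}_n$ acts on $I^n$ by $w.\nu=(\nu_{w^{-1}(1)},\dots,\nu_{w^{-1}(n)})$; $I^\beta=\{\nu\in I^n:\sum_k\alpha_{\nu_k}=\beta\}$; $s_k=(k,k+1)$. $\mathbb{N}$ contains $0$. **KLR algebra.** $\mathbf{k}=\bigoplus_{m\ge0}\mathbf{k}_m$ is a graded commutative integral domain (possibly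 concentrated in degree $0$; not assumed Noetherian or a field). Fix $Q_{i,j}\in\mathbf{k}[u,v]$ with $Q_{i,i}=0$, $Q_{i,j}(u,v)=Q_{j,i}(v,u)$, and for $i\ne j$, $Q_{i,j}(u,v)=\sum_{p,q\ge0}c_{i,j,p,q}u^pv^q$ with $c_{i,j,p,q}\in\mathbf{k}_{-2(\alpha_i,\alpha_j)-(\alpha_i,\alpha_i)p-(\alpha_j,\alpha_j)q}$ (so zero when this degree is negative) and $c_{i,j,-a_{ij},0}\in\mathbf{k}_0^\times$. $\mathscr{R}_\beta$ is the associative $\mathbf{k}$-algebra generated by $e(\nu)$ ($\nu\in I^\beta$), $x_1,\dots,x_n$, $\tau_1,\dots,\tau_{n-1}$ with relations: $e(\nu)e(\nu')=\delta_{\nu\nu'}e(\nu)$, $\sum_\nu e(\nu)=1$, $x_kx_l=x_lx_k$, $x_ke(\nu)=e(\nu)x_k$, $\tau_le(\nu)=e(s_l.\nu)\tau_l$, $\tau_k\tau_l=\tau_l\tau_k$ if $|k-l|>1$, $\tau_k^2e(\nu)=Q_{\nu_k,\nu_{k+1}}(x_k,x_{k+1})e(\nu)$; $(\tau_kx_l-x_{s_k(l)}\tau_k)e(\nu)=-e(\nu)$ if $l=k,\nu_k=\nu_{k+1}$, $=e(\nu)$ if $l=k+1,\nu_k=\nu_{k+1}$, $=0$ otherwise; $(\tau_{k+1}\tau_k\tau_{k+1}-\tau_k\tau_{k+1}\tau_k)e(\nu)=\frac{Q_{\nu_k,\nu_{k+1}}(x_k,x_{k+1})-Q_{\nu_{k+2},\nu_{k+1}}(x_{k+2},x_{k+1})}{x_k-x_{k+2}}e(\nu)$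 if $\nu_k=\nu_{k+2}$, $=0$ otherwise. For each $w\in\mathfrak{S}_n$ fix a reduced expression $w=s_{j_1}\cdots s_{j_r}$ and put $\tau_w=\tau_{j_1}\cdots\tau_{j_r}$; $\mathscr{R}_\beta$ is known to be free over $\mathbf{k}$ with basis $\{\tau_wx^{\underline a}e(\nu)\}$, $x^{\underline a}=x_1^{a_1}\cdots x_n^{a_n}$. **Cyclotomic quotient.** For each $i\in I$ fix a monic polynomial $a_i^\Lambda(u)=\sum_{k=0}^{\langle\alpha_i^\vee,\Lambda\rangle}c_{i;k}u^{\langle\alpha_i^\vee,\Lambda\rangle-k}$ with $c_{i;0}=1$, $c_{i;k}\in\mathbf{k}_{k(\alpha_i,\alpha_i)}$. $I_{\Lambda,\beta}$ is the two-sided ideal of $\mathscr{R}_\beta$ generated by $\sum_{\nu\in I^\beta}a^\Lambda_{\nu_1}(x_1)e(\nu)$, and $\mathscr{R}_\beta^\Lambda=\mathscr{R}_\beta/I_{\Lambda,\beta}$. **The polynomials $g^\Lambda_{w,\nu,k}$.** Given $w\in\mathfrak{S}_n$ and $\nu\in I^\beta$, put $\widetilde\nu=w.\nu$ and order $\{i_1,\dots,i_n\}$ by $\widetilde\nu_s\prec\widetilde\nu_t\Leftrightarrow s<t$. With respect to this order define, for all $\mu\in I^\beta$, $g_{\mu,1}=a^\Lambda_{\mu_1}(x_1)$ and, for $1\le k<n$, $g_{\mu,k+1}=s_k(g_{s_k.\mu,k})$ if $\mu_k\succ\mu_{k+1}$, and $g_{\mu,k+1}=s_k(g_{s_k.\mu,k})\cdot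 Q_{\mu_k,\mu_{k+1}}(x_k,x_{k+1})$ if $\mu_k\prec\mu_{k+1}$, where $s_k$ acts on polynomials by exchanging $x_k,x_{k+1}$. Then $g^\Lambda_{w,\nu,k}:=g_{\nu,k}$. *)

(* Defs.v *)
From HB Require Import structures.
From mathcomp Require Import all_boot all_order all_fingroup all_algebra.
From mathcomp Require Import generic_quotient boolp.
From mathcomp Require Import mpoly.
From mathcomp Require monalg.

Set Implicit Arguments.
Unset Strict Implicit.
Unset Printing Implicit Defensive.

Import Order.TTheory GRing.Theory Num.Theory.
Local Open Scope ring_scope.
Local Open Scope quotient_scope.

(* MathComp's algType requires 1 != 0, which fails for some cyclotomic
   quotients (e.g. Lambda = 0). A k-algebra is therefore presented as a ring with
   a central ring morphism from k; the k-module structure is c *: u = algc c * u. *)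
HB.mixin Record isPzAlgebra (k : pzRingType) A of GRing.PzRing A := {
  algc : k -> A;
  algcB : zmod_morphism algc;
  algcM : monoid_morphism algc;
  algcC : forall (c : k) (u : A), algc c * u = u * algc c
}.

#[short(type="pzAlgType")]
HB.structure Definition PzAlgebra (k : pzRingType) :=
  { A of GRing.PzRing A & isPzAlgebra k A }.

(* monalg is imported only here: its notations clash with those of mpoly. *)
Section FreeAlgebra.
Import monalg.
Variables (k : comNzRingType) (G : choiceType).

Lemma malgC_central (c : k) (u : {malg k[{fmonom G}]}) :
  malgC c * u = u * malgC c.
Proof.
rewrite (monalgE u) mulr_sumr mulr_suml; apply: eq_bigr => m _.
have mE (a b : k) (x y : {fmonom G}) : << a *g x >> * << b *g y >>
  = << a * b *g mmul x y >> :> {malg k[{fmonom G}]} by exact: fgmulUU.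
by rewrite !mE mulrC mul1m mulm1.
Qed.

Definition free_alg := {malg k[{fmonom G}]}.
HB.instance Definition _ := GRing.NzRing.on free_alg.
HB.instance Definition _ := isPzAlgebra.Build k free_alg
  (raddfB (@malgC {fmonom G} k)) (rmorph1 (@malgC {fmonom G} k), rmorphM (@malgC {fmonom G} k))
  malgC_central.

Definition free_gen (g : G) : free_alg := << fmu g >>.

End FreeAlgebra.

Inductive ideal_gen (A : pzRingType) (X : A -> Prop) : A -> Prop :=
| ideal_gen0 : ideal_gen X 0
| ideal_genD a r b u : X r -> ideal_gen X u -> ideal_gen X (a * r * b + u).

Section Quotient.
Variables (k : pzRingType) (A : pzAlgType k) (X : A -> Prop).
Local Notation J := (ideal_gen X).

Lemma ideal_genDr u v : J u -> J v -> J (u + v).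
Proof.
elim=> [|a r b u' Xr _ IH] Jv; first by rewrite add0r.
by rewrite -addrA; apply: ideal_genD => //; apply: IH.
Qed.

Lemma ideal_genMl a u : J u -> J (a * u).
Proof.
elim=> [|a' r b u' Xr _ IH]; first by rewrite mulr0; left.
by rewrite mulrDr !mulrA; right.
Qed.

Lemma ideal_genMr b u : J u -> J (u * b).
Proof.
elim=> [|a r b' u' Xr _ IH]; first by rewrite mul0r; left.
by rewrite mulrDl -mulrA; right.
Qed.

Lemma ideal_genN u : J u -> J (- u).
Proof. by move=> Ju; rewrite -mulN1r; apply: ideal_genMl. Qed.

(* Classical: membership in the ideal is decided by boolp. *)
Definition ideal_rel (u v : A) : bool := `[< J (u - v) >].

Lemma ideal_rel_refl : reflexive ideal_rel.
Proof. by move=> u; apply/asboolP; rewrite subrr; left. Qed.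

Lemma ideal_rel_sym : ssrbool.symmetric ideal_rel.
Proof.
by move=> u v; apply/asboolP/asboolP => /ideal_genN; rewrite opprB.
Qed.

Lemma ideal_rel_trans : transitive ideal_rel.
Proof.
move=> v u w /asboolP uv /asboolP vw; apply/asboolP.
by rewrite -[u](subrK v) -addrA; apply: ideal_genDr.
Qed.

Canonical ideal_equiv := EquivRel ideal_rel
  ideal_rel_refl ideal_rel_sym ideal_rel_trans.
Canonical ideal_encModRel := defaultEncModRel ideal_rel.

Definition alg_quot := {eq_quot ideal_rel}.
HB.instance Definition _ := Choice.on alg_quot.
HB.instance Definition _ := EqQuotient.on alg_quot.

Lemma alg_quotP (u v : A) : (\pi_alg_quot u = \pi_alg_quot v) <-> J (u - v).
Proof.
by split=> [/eqP | Ju]; [|apply/eqP];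
  rewrite eqmodE => //; [move/asboolP|apply/asboolP].
Qed.

Let pi u := \pi_alg_quot u.

Definition aq_zero := pi 0.
Definition aq_one := pi 1.
Definition aq_opp (p : alg_quot) := pi (- repr p).
Definition aq_add (p q : alg_quot) := pi (repr p + repr q).
Definition aq_mul (p q : alg_quot) := pi (repr p * repr q).
Definition aq_algc (c : k) := pi (algc c).

Lemma repr_pi u : J (repr (pi u) - u).
Proof. by apply/alg_quotP; rewrite reprK. Qed.

Lemma aq_oppE u : aq_opp (pi u) = pi (- u).
Proof. by apply/alg_quotP; rewrite -opprD; apply/ideal_genN/repr_pi. Qed.

Lemma aq_addE u v : aq_add (pi u) (pi v) = pi (u + v).
Proof.
apply/alg_quotP; rewrite opprD addrACA.
by apply: ideal_genDr; apply: repr_pi.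
Qed.

Lemma aq_mulE u v : aq_mul (pi u) (pi v) = pi (u * v).
Proof.
apply/alg_quotP; rewrite -[X in X - _](subrK (u * repr (pi v))) -mulrBl.
rewrite -addrA -mulrBr; apply: ideal_genDr.
  exact/ideal_genMr/repr_pi.
exact/ideal_genMl/repr_pi.
Qed.

Let aqE := (aq_oppE, aq_addE, aq_mulE).

Lemma aq_ind (P : alg_quot -> Prop) : (forall u, P (pi u)) -> forall p, P p.
Proof. by move=> H p; rewrite -[p]reprK. Qed.

Lemma aq_addA : associative aq_add.
Proof.
by elim/aq_ind=> u; elim/aq_ind=> v; elim/aq_ind=> w; rewrite !aqE addrA.
Qed.

Lemma aq_addC : commutative aq_add.
Proof. by elim/aq_ind=> u; elim/aq_ind=> v; rewrite !aqE addrC. Qed.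

Lemma aq_add0 : left_id aq_zero aq_add.
Proof. by elim/aq_ind=> u; rewrite aqE add0r. Qed.

Lemma aq_addN : left_inverse aq_zero aq_opp aq_add.
Proof. by elim/aq_ind=> u; rewrite !aqE addNr. Qed.

HB.instance Definition _ :=
  GRing.isZmodule.Build alg_quot aq_addA aq_addC aq_add0 aq_addN.

Lemma aq_mulA : associative aq_mul.
Proof.
by elim/aq_ind=> u; elim/aq_ind=> v; elim/aq_ind=> w; rewrite !aqE mulrA.
Qed.

Lemma aq_mul1l : left_id aq_one aq_mul.
Proof. by elim/aq_ind=> u; rewrite aqE mul1r. Qed.

Lemma aq_mul1r : right_id aq_one aq_mul.
Proof. by elim/aq_ind=> u; rewrite aqE mulr1. Qed.

Lemma aq_mulDl : left_distributive aq_mul aq_add.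
Proof.
by elim/aq_ind=> u; elim/aq_ind=> v; elim/aq_ind=> w; rewrite !aqE mulrDl.
Qed.

Lemma aq_mulDr : right_distributive aq_mul aq_add.
Proof.
by elim/aq_ind=> u; elim/aq_ind=> v; elim/aq_ind=> w; rewrite !aqE mulrDr.
Qed.

HB.instance Definition _ := GRing.Zmodule_isPzRing.Build alg_quot
  aq_mulA aq_mul1l aq_mul1r aq_mulDl aq_mulDr.

Lemma aq_algcB : zmod_morphism aq_algc.
Proof.
move=> a b; rewrite [RHS](_ : _ = aq_add (pi (algc a)) (aq_opp (pi (algc b)))) //.
by rewrite !aqE /aq_algc algcB.
Qed.

Lemma aq_algcM : monoid_morphism aq_algc.
Proof.
split=> [|a b]; first by rewrite /aq_algc algcM.1.
by rewrite [RHS]aq_mulE /aq_algc algcM.2.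
Qed.

Lemma aq_algcC (c : k) (p : alg_quot) : aq_algc c * p = p * aq_algc c.
Proof.
by elim/aq_ind: p => u; rewrite [LHS]aq_mulE [RHS]aq_mulE algcC.
Qed.

HB.instance Definition _ :=
  isPzAlgebra.Build k alg_quot aq_algcB aq_algcM aq_algcC.

Definition aq_scale (c : k) (p : alg_quot) : alg_quot := algc c * p.

Lemma aq_scaleA a b p : aq_scale a (aq_scale b p) = aq_scale (a * b) p.
Proof. by rewrite /aq_scale mulrA (algcM.2). Qed.

Lemma aq_scale1 : left_id 1 aq_scale.
Proof. by move=> p; rewrite /aq_scale (algcM.1) mul1r. Qed.

Lemma aq_scaleDr : right_distributive aq_scale +%R.
Proof. by move=> c p q; rewrite /aq_scale mulrDr. Qed.

Lemma aq_scaleDl p : {morph aq_scale^~ p : a b / a + b}.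
Proof.
move=> a b; rewrite /aq_scale -mulrDl; congr (_ * _).
have B : zmod_morphism (algc : k -> alg_quot) by exact: algcB.
have N c : algc (- c) = - algc c :> alg_quot.
  by rewrite -sub0r B -(subrr c) B subrr sub0r.
by rewrite -[b in LHS]opprK B N opprK.
Qed.

HB.instance Definition _ := GRing.Zmodule_isLmodule.Build k alg_quot
  aq_scaleA aq_scale1 aq_scaleDr aq_scaleDl.

Definition to_quot (u : A) : alg_quot := \pi_alg_quot u.

Lemma to_quotD u v : to_quot (u + v) = to_quot u + to_quot v.
Proof. by rewrite [RHS]aq_addE. Qed.

Lemma to_quotM u v : to_quot (u * v) = to_quot u * to_quot v.
Proof. by rewrite [RHS]aq_mulE. Qed.

Lemma to_quot_algc c : to_quot (algc c) = algc c.
Proof. by []. Qed.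

Lemma to_quotP u v : to_quot u = to_quot v <-> J (u - v).
Proof. exact: alg_quotP. Qed.

End Quotient.

(* The index set is a finType because P has finite rank and the simple roots
   are linearly independent. *)
Record cartan_datum := CartanDatum {
  cartan_index :> finType;
  cartan : cartan_index -> cartan_index -> int;
  cartan_diag : forall i, cartan i i = 2;
  cartan_le0 : forall i j, i != j -> cartan i j <= 0;
  cartan_eq0 : forall i j, cartan i j = 0 <-> cartan j i = 0;
  cartan_d : cartan_index -> int;
  cartan_d_gt0 : forall i, 0 < cartan_d i;
  cartan_sym : forall i j, cartan_d i * cartan i j = cartan_d j * cartan j i;
  weight_lattice : zmodType;
  weight_free : exists (r : nat) (b : 'I_r -> weight_lattice),
    forall v, exists! c : {ffun 'I_r -> int}, v = \sum_i b i *~ c i;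
  simple_root : cartan_index -> weight_lattice;
  root_free : forall c : cartan_index -> int,
    \sum_i simple_root i *~ c i = 0 -> forall i, c i = 0;
  simple_coroot : cartan_index -> {additive weight_lattice -> int};
  coroot_free : forall c : cartan_index -> int,
    (forall v, \sum_i c i * simple_coroot i v = 0) -> forall i, c i = 0;
  coroot_root : forall i j, simple_coroot i (simple_root j) = cartan i j;
  fund_weight : cartan_index -> weight_lattice;
  coroot_fund : forall i j, simple_coroot j (fund_weight i) = (i == j)%:R
}.

Definition dominant (C : cartan_datum) (L : weight_lattice C) : Prop :=
  forall i : C, 0 <= simple_coroot i L.

Definition root_form (C : cartan_datum) (i j : C) : int :=
  cartan_d i * cartan i j.

(* k is the internal direct sum of additive subgroups k_m, m >= 0. *)
Record grading (k : idomainType) := Grading {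
  gr_part :> nat -> k -> Prop;
  gr_0 : forall m, gr_part m 0;
  gr_B : forall m a b, gr_part m a -> gr_part m b -> gr_part m (a - b);
  gr_1 : gr_part 0%N 1;
  gr_M : forall m m' a b,
    gr_part m a -> gr_part m' b -> gr_part (m + m')%N (a * b);
  gr_sum : forall a, exists (N : nat) (f : nat -> k),
    (forall m, gr_part m (f m)) /\ a = \sum_(m < N) f m;
  gr_direct : forall (N : nat) (f : nat -> k), (forall m, gr_part m (f m)) ->
    \sum_(m < N) f m = 0 -> forall m, (m < N)%N -> f m = 0
}.

Definition gr_deg (k : idomainType) (gr : grading k) (d : int) (a : k) : Prop :=
  if d is Posz m then gr m a else a = 0.

(* q(x_a, x_b), where 'X_0 and 'X_1 in {mpoly k[2]} stand for u and v. *)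
Definition subst2 (k : comNzRingType) (n : nat) (q : {mpoly k[2]})
    (a b : 'I_n) : {mpoly k[n]} :=
  q \mPo [tuple 'X_a; 'X_b].

Lemma braid_quot_exists (k : comNzRingType) (n : nat) (q : {mpoly k[2]})
    (a b c : 'I_n) :
  exists D : {mpoly k[n]},
    D * ('X_a - 'X_c) = subst2 q a b - subst2 q c b.
Proof.
exists (\sum_(m <- msupp q) q@_m *:
  (\sum_(i < m ord0) 'X_a ^+ ((m ord0).-1 - i) * 'X_c ^+ i) * 'X_b ^+ m ord_max).
rewrite /subst2 !comp_mpolyE -sumrB mulr_suml; apply: eq_bigr => m _.
rewrite -scalerBr !big_ord_recl !big_ord0 !mulr1 -mulrBl subrXX.
rewrite -!scalerAl; congr (_ *: _); rewrite /=.
have -> : lift ord0 ord0 = ord_max :> 'I_2 by apply/val_inj.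
by rewrite mulrAC; congr (_ * _); rewrite mulrC.
Qed.

Record klr_datum (k : idomainType) (gr : grading k) (C : cartan_datum) :=
KlrDatum {
  klr_Q :> C -> C -> {mpoly k[2]};
  klr_Q_diag : forall i, klr_Q i i = 0;
  klr_Q_sym : forall i j, klr_Q i j = subst2 (klr_Q j i) ord_max ord0;
  klr_Q_deg : forall i j, i != j -> forall m : 'X_{1..2},
    gr_deg gr (- 2 * root_form i j - root_form i i * (m ord0)%:Z
               - root_form j j * (m ord_max)%:Z) (klr_Q i j)@_m;
  klr_Q_unit : forall i j, i != j ->
    let c := (klr_Q i j)@_(U_(ord0) *+ `|cartan i j|%N)%MM in
    gr 0%N c /\ exists2 c', gr 0%N c' & c * c' = 1
}.

Record cyclo_datum (k : idomainType) (gr : grading k) (C : cartan_datum)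
    (L : weight_lattice C) :=
CycloDatum {
  cyclo_pol :> C -> {poly k};
  cyclo_monic : forall i, cyclo_pol i \is monic;
  cyclo_size : forall i, (size (cyclo_pol i))%:Z = simple_coroot i L + 1;
  cyclo_deg : forall i (j : nat), (j <= `|simple_coroot i L|)%N ->
    gr_deg gr (j%:Z * root_form i i) (cyclo_pol i)`_(`|simple_coroot i L| - j)%N
}.

(* There are n.+1 strands, numbered from 0: position t of the literature is
   t - 1 here. *)

Section Sequences.
Variables (C : cartan_datum) (n : nat) (beta : weight_lattice C).

Definition iseq : Type :=
  {nu : {ffun 'I_n.+1 -> C} | \sum_k simple_root (nu k) == beta}.
HB.instance Definition _ := Finite.on iseq.

Definition iseq_fun (nu : iseq) : 'I_n.+1 -> C := val nu.
Coercion iseq_fun : iseq >-> Funclass.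

Definition act_fun (w : 'S_n.+1) (nu : iseq) : {ffun 'I_n.+1 -> C} :=
  [ffun t => nu ((w^-1)%g t)].

Lemma act_subproof w nu : \sum_k simple_root (act_fun w nu k) == beta.
Proof.
rewrite -(eqP (valP nu)) (reindex_perm w) /=; apply/eqP/eq_bigr => t _.
by rewrite ffunE permK.
Qed.

Definition iseq_act (w : 'S_n.+1) (nu : iseq) : iseq :=
  exist _ (act_fun w nu) (act_subproof w nu).

End Sequences.

Definition adjtr (n l : nat) : 'S_n.+1 := tperm (inord l) (inord l.+1).

(* Permutations of MathComp compose from left to right, hence the rev: this is
   the composite of maps adjtr l_1 \o ... \o adjtr l_r. *)
Definition word_perm (n : nat) (s : seq 'I_n) : 'S_n.+1 :=
  (\prod_(l <- rev s) adjtr n l)%g.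

Definition reduced_expr (n : nat) (w : 'S_n.+1) (s : seq 'I_n) : Prop :=
  word_perm s = w /\ forall s', word_perm s' = w -> (size s <= size s')%N.

Section PolEval.
Variables (k : comNzRingType) (A : pzAlgType k) (n : nat) (x : 'I_n -> A).

Definition xmon (m : 'X_{1..n}) : A := \prod_(i < n) x i ^+ m i.

Definition xpol (p : {mpoly k[n]}) : A :=
  \sum_(m <- msupp p) algc p@_m * xmon m.

End PolEval.

Section KLR.
Variables (k : idomainType) (gr : grading k) (C : cartan_datum).
Variables (Q : klr_datum gr C) (n : nat) (beta : weight_lattice C).

Local Notation I_beta := (iseq n beta).

Definition klr_gen : Type := (I_beta + 'I_n.+1 + 'I_n)%type.
HB.instance Definition _ := Finite.on klr_gen.

Definition klr_free := free_alg k klr_gen.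
HB.instance Definition _ := PzAlgebra.on klr_free.

Definition free_e (nu : I_beta) : klr_free :=
  free_gen k (inl (inl nu) : klr_gen).
Definition free_x (j : 'I_n.+1) : klr_free :=
  free_gen k (inl (inr j) : klr_gen).
Definition free_tau (l : 'I_n) : klr_free := free_gen k (inr l : klr_gen).

Local Notation e := free_e.
Local Notation x := free_x.
Local Notation tau := free_tau.
Local Notation "@@ l" := (inord l : 'I_n.+1) (at level 8, format "@@ l").

(* In klr_braid, D is the exact quotient by x_k - x_{k+2}; it exists by
   braid_quot_exists and is unique since {mpoly k[n.+1]} is a domain. *)
Variant klr_rel : klr_free -> klr_free -> Prop :=
| klr_ee nu nu' :
    klr_rel (e nu * e nu') (if nu == nu' then e nu else 0)
| klr_sum_e :
    klr_rel (\sum_nu e nu) 1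
| klr_xx i j :
    klr_rel (x i * x j) (x j * x i)
| klr_xe j nu :
    klr_rel (x j * e nu) (e nu * x j)
| klr_tau_e l nu :
    klr_rel (tau l * e nu) (e (iseq_act (adjtr n l) nu) * tau l)
| klr_tau_tau (l l' : 'I_n) : (l.+1 < l')%N || (l'.+1 < l)%N ->
    klr_rel (tau l * tau l') (tau l' * tau l)
| klr_tau2 l (nu : I_beta) :
    klr_rel (tau l * tau l * e nu)
      (xpol x (subst2 (Q (nu @@l) (nu @@l.+1)) @@l @@l.+1) * e nu)
| klr_tau_x l j (nu : I_beta) :
    klr_rel ((tau l * x j - x (adjtr n l j) * tau l) * e nu)
      (if (j == @@l) && (nu @@l == nu @@l.+1) then - e nu
       else if (j == @@l.+1) && (nu @@l == nu @@l.+1) then e nu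
       else 0)
| klr_braid0 (l l' : 'I_n) (nu : I_beta) : l' = l.+1 :> nat -> nu @@l != nu @@l.+2 ->
    klr_rel ((tau l' * tau l * tau l' - tau l * tau l' * tau l) * e nu) 0
| klr_braid (l l' : 'I_n) (nu : I_beta) (D : {mpoly k[n.+1]}) :
    l' = l.+1 :> nat -> nu @@l = nu @@l.+2 ->
    D * ('X_(@@l) - 'X_(@@l.+2)) =
      subst2 (Q (nu @@l) (nu @@l.+1)) @@l @@l.+1
      - subst2 (Q (nu @@l.+2) (nu @@l.+1)) @@l.+2 @@l.+1 ->
    klr_rel ((tau l' * tau l * tau l' - tau l * tau l' * tau l) * e nu)
      (xpol x D * e nu).

Definition klr_relator (u : klr_free) : Prop :=
  exists v w, klr_rel v w /\ u = v - w.

Definition klr := alg_quot klr_relator.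
HB.instance Definition _ := PzAlgebra.on klr.
HB.instance Definition _ := GRing.Lmodule.on klr.

Definition klr_e (nu : I_beta) : klr := to_quot klr_relator (e nu).
Definition klr_x (j : 'I_n.+1) : klr := to_quot klr_relator (x j).
Definition klr_tau (l : 'I_n) : klr := to_quot klr_relator (tau l).
Definition klr_tau_word (s : seq 'I_n) : klr := \prod_(l <- s) klr_tau l.

Variables (L : weight_lattice C) (a : cyclo_datum gr L).

(* a^Lambda_{nu_1}(x_1) *)
Definition cyclo_at (nu : I_beta) : {mpoly k[n.+1]} :=
  (map_poly (@mpolyC n.+1 k) (a (nu ord0))).['X_ord0].

Definition cyclo_gen : klr := \sum_nu xpol klr_x (cyclo_at nu) * klr_e nu.

Definition cyclo_ideal : klr -> Prop := ideal_gen (fun u => u = cyclo_gen).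

Definition cyclo_klr := alg_quot (fun u : klr => u = cyclo_gen).
HB.instance Definition _ := PzAlgebra.on cyclo_klr.
HB.instance Definition _ := GRing.Lmodule.on cyclo_klr.

Definition to_cyclo (u : klr) : cyclo_klr :=
  to_quot (fun u => u = cyclo_gen) u.

Definition prec (w : 'S_n.+1) (nu : I_beta) (i j : C) : bool :=
  [exists s : 'I_n.+1, exists t : 'I_n.+1,
    [&& iseq_act w nu s == i, iseq_act w nu t == j & (s < t)%N]].

(* The polynomials g_{mu,j+1} for the order attached to (w, nu), meaningful
   for j < n.+1; j is one less than in the literature. *)
Fixpoint gpol_rec (w : 'S_n.+1) (nu : I_beta) (j : nat) (mu : I_beta) :
    {mpoly k[n.+1]} :=
  if j is l.+1 then
    let g := msym (adjtr n l) (gpol_rec w nu l (iseq_act (adjtr n l) mu)) in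
    if prec w nu (mu @@l) (mu @@l.+1) then
      g * subst2 (Q (mu @@l) (mu @@l.+1)) @@l @@l.+1
    else g
  else cyclo_at mu.

Definition gpol (w : 'S_n.+1) (nu : I_beta) (j : 'I_n.+1) : {mpoly k[n.+1]} :=
  gpol_rec w nu j nu.

(* <alpha_{nu_t}^vee, Lambda> - sum_{l < t, w(l) < w(t)} a_{nu_t, nu_l} *)
Definition exp_bound (w : 'S_n.+1) (nu : I_beta) (t : 'I_n.+1) : int :=
  simple_coroot (nu t) L
  - \sum_(l < n.+1 | (l < t)%N && (w l < w t)%N) cartan (nu t) (nu l).

End KLR.

Definition is_basis (k : pzRingType) (V : lmodType k) (J : eqType)
    (D : J -> Prop) (b : J -> V) (M : V -> Prop) : Prop :=
  [/\ forall j, D j -> M (b j),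
      forall v, M v -> exists (s : seq J) (c : J -> k),
        (forall j, j \in s -> D j) /\ v = \sum_(j <- s) c j *: b j
    & forall (s : seq J) (c : J -> k), uniq s -> (forall j, j \in s -> D j) ->
        \sum_(j <- s) c j *: b j = 0 -> forall j, j \in s -> c j = 0].

(* Main.v *)
Require Import Defs.
From HB Require Import structures.
From mathcomp Require Import all_boot all_order all_fingroup all_algebra.
From mathcomp Require Import generic_quotient mpoly zify.
From mathcomp Require finmap monalg.

(** When the colours are pairwise distinct, every nu in I^beta is an arrangement
of them, and no relation of the KLR algebra R has a correction term: such a term
needs two equal colours. Attach a variable y_c to each colour c, acting on
e(nu) as x_t where t is the position of c in nu. The y_c are central, and R
is free over the polynomials in the y_c on the elements tau_w e(nu), where
two of these multiply to the next one times the product of Q_cd(y_c, y_d) over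
the pairs {c, d} that cross twice.

Spanning (klr_span) holds because tau_w does not depend on the reduced word
(matsumoto), so that the span of the tau_w e(nu) is stable under the
generators. Freeness comes from a representation by matrices indexed by I^beta
(klr_model): tau_w e(nu) goes to the matrix whose only entry, at (w.nu, nu), is
the product of Q over the pairs that are in a fixed reference order in w.nu
and reversed in nu. This product is not zero, since Q_cd has a unit leading
coefficient; hence the coefficient polynomials can be read off the entries
(klr_comb_eq0).

The entries of the cyclotomic ideal at (mu, nu) form, up to the same factor,
an ideal of polynomials, generated by the products of a_c(y_c) with the
Q_dc(y_d, y_c) for all d to the left of c in both mu and nu. These are the
polynomials g (gpol_recE, msym_gpol). They belong to the ideal since moving c to
the front from nu, and from there to mu, costs exactly these factors
(tau_gpol_rec_ideal); they exhaust it since the matrices with such entries are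
stable under multiplication on both sides (in_idealMl, in_idealMr), which rests
on crossing_common_left. So an element sum tau_w f e(nu) lies in the ideal iff
each f lies in the ideal of the g_(w,nu,k) (cyclo_id_combP).

It remains to do linear algebra with polynomials. The polynomial g_(w,nu,k) only
involves x_1, ..., x_k, and it is monic in x_k up to a unit, of degree the
exponent bound of the theorem (gpol_lead). For such a triangular family, division
with remainder from the last variable to the first writes every polynomial
uniquely as a combination of the g_k, with coefficients bounded in the
variables after x_k, plus a remainder bounded in all variables (normal_form,
normal_form_uniq), and the remainder vanishes on the ideal
(ideal_normal_form). *)

Set Implicit Arguments.
Unset Strict Implicit.
Unset Printing Implicit Defensive.

Import Order.TTheory GRing.Theory Num.Theory.
Local Open Scope ring_scope.

(** * Triangular families of polynomials *)

Section TriangularFamilies.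
Variables (k : idomainType) (n : nat).
Implicit Types (f g p q r : {mpoly k[n]}) (m : 'X_{1..n}) (t s : 'I_n).

Definition supp_in (P : 'X_{1..n} -> Prop) p : Prop :=
  forall m, m \in msupp p -> P m.

Lemma supp_in0 P : supp_in P 0.
Proof. by move=> m; rewrite msupp0. Qed.

Lemma supp_inD P p q : supp_in P p -> supp_in P q -> supp_in P (p + q).
Proof.
by move=> Pp Pq m /msuppD_le; rewrite mem_cat => /orP[/Pp | /Pq].
Qed.

Lemma supp_inZ P c p : supp_in P p -> supp_in P (c *: p).
Proof. by move=> Pp m /msuppZ_le /Pp. Qed.

Lemma supp_inN P p : supp_in P p -> supp_in P (- p).
Proof. by rewrite -scaleN1r; apply: supp_inZ. Qed.

Lemma supp_in_sum P (I : Type) (s : seq I) (C : pred I) F :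
  (forall i, C i -> supp_in P (F i)) -> supp_in P (\sum_(i <- s | C i) F i).
Proof. by move=> PF; apply: big_ind => //; [apply: supp_in0 | apply: supp_inD]. Qed.

Lemma supp_inX (P : 'X_{1..n} -> Prop) m : P m -> supp_in P 'X_[m].
Proof. by move=> Pm m'; rewrite msuppX inE => /eqP ->. Qed.

Lemma supp_inM (P1 P2 P : 'X_{1..n} -> Prop) p q :
    (forall m1 m2, P1 m1 -> P2 m2 -> P (m1 + m2)%MM) ->
  supp_in P1 p -> supp_in P2 q -> supp_in P (p * q).
Proof.
move=> PM Pp Pq m /msuppM_le /allpairsP[[m1 m2] /= [/Pp P1m /Pq P2m ->]].
exact: PM.
Qed.

Lemma supp_inW (P P' : 'X_{1..n} -> Prop) p :
  (forall m, P m -> P' m) -> supp_in P p -> supp_in P' p.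
Proof. by move=> PP' Pp m /Pp /PP'. Qed.

(** Monomials that may follow the leading power of 'X_t in a polynomial of the
variables up to t. *)
Definition below t (b : nat) m : Prop :=
  (m t < b)%N /\ forall s, (t < s)%N -> m s = 0%N.

(** Up to a unit, monic of degree b in 'X_t over the polynomials in the
variables before t. *)
Definition unit_lead t (b : nat) g : Prop :=
  exists (u : k) r, [/\ u \is a GRing.unit,
    g = u *: 'X_[U_(t) *+ b] + r & supp_in (below t b) r].

Lemma mnmUnE t b s : (U_(t) *+ b)%MM s = ((t == s) * b)%N.
Proof. by rewrite mulmnE mnm1E. Qed.

Lemma unit_lead1 t : unit_lead t 0 1.
Proof.
exists 1, 0; split; [exact: unitr1 | | exact: supp_in0].
by rewrite mulm0n addr0 scale1r mpolyX0.
Qed.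

Lemma unit_leadM t b1 b2 g1 g2 :
  unit_lead t b1 g1 -> unit_lead t b2 g2 -> unit_lead t (b1 + b2) (g1 * g2).
Proof.
move=> [u1 [r1 [U1 -> R1]]] [u2 [r2 [U2 -> R2]]].
have Xle b : supp_in (fun m => (m t <= b)%N /\ forall s, (t < s)%N -> m s = 0%N)
    ('X_[U_(t) *+ b] : {mpoly k[n]}).
  apply: supp_inX; split=> [|s ts]; rewrite mnmUnE ?eqxx ?mul1n //.
  by rewrite -val_eqE /= ltn_eqF.
exists (u1 * u2), (u1 *: 'X_[U_(t) *+ b1] * r2 + r1 * (u2 *: 'X_[U_(t) *+ b2])
  + r1 * r2); split; first by rewrite unitrM U1.
  have -> : (U_(t) *+ (b1 + b2) = U_(t) *+ b1 + U_(t) *+ b2)%MM.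
    by apply/mnmP => s; rewrite mnmDE !mnmUnE mulnDr.
  rewrite mpolyXD mulrDl !mulrDr -!addrA; congr (_ + _).
  by rewrite -scalerAl -scalerAr scalerA.
have Bz m1 m2 : (forall s, (t < s)%N -> m1 s = 0%N) ->
    (forall s, (t < s)%N -> m2 s = 0%N) ->
    forall s, (t < s)%N -> (m1 + m2)%MM s = 0%N.
  by move=> H1 H2 s ts; rewrite mnmDE H1 // H2.
apply: supp_inD; first apply: supp_inD.
- rewrite -scalerAl; apply: supp_inZ; apply: supp_inM (Xle b1) R2.
  move=> m1 m2 [l1 z1] [l2 z2]; split; last exact: Bz.
  by rewrite mnmDE -addnS leq_add.
- rewrite -scalerAr; apply: supp_inZ; apply: supp_inM R1 (Xle b2).
  move=> m1 m2 [l1 z1] [l2 z2]; split; last exact: Bz.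
  by rewrite mnmDE -addSn leq_add.
apply: supp_inM R1 R2 => m1 m2 [l1 z1] [l2 z2]; split; last exact: Bz.
by rewrite mnmDE -addSn leq_add // ltnW.
Qed.

Lemma unit_lead_prod t (I : Type) (s : seq I) (C : pred I) b F :
  (forall i, C i -> unit_lead t (b i) (F i)) ->
  unit_lead t (\sum_(i <- s | C i) b i) (\prod_(i <- s | C i) F i).
Proof.
move=> H; elim/big_rec2: _ => [|i c g Ci IH]; first exact: unit_lead1.
by apply: unit_leadM => //; apply: H.
Qed.

(** Division by g with respect to 'X_t only touches the variables up to t, so
any condition B on the exponents of the later variables survives. *)
Lemma unit_lead_div t b g (B : 'X_{1..n} -> Prop) :
    unit_lead t b g ->
    (forall m m', B m -> (forall s, (t < s)%N -> m' s = m s) -> B m') ->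
  forall f, supp_in B f -> exists q r,
    [/\ f = q * g + r, supp_in B q, supp_in B r
      & supp_in (fun m => (m t < b)%N) r].
Proof.
move=> [u [low [Uu gE lowP]]] Bext.
pose D f := exists q r, [/\ f = q * g + r, supp_in B q, supp_in B r
      & supp_in (fun m => (m t < b)%N) r].
have D0 : D 0.
  by exists 0, 0; rewrite mul0r addr0; split=> //; apply: supp_in0.
have DD f1 f2 : D f1 -> D f2 -> D (f1 + f2).
  move=> [q1 [r1 [-> Bq1 Br1 R1]]] [q2 [r2 [-> Bq2 Br2 R2]]].
  exists (q1 + q2), (r1 + r2); split; try exact: supp_inD.
  by rewrite mulrDl addrACA.
have DZ c f : D f -> D (c *: f).
  move=> [q [r [-> Bq Br R]]]; exists (c *: q), (c *: r).
  by split; try exact: supp_inZ; rewrite scalerDr scalerAl.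
suff DX m : B m -> D 'X_[m].
  move=> f Bf; rewrite (mpolyE f) big_seq; apply: (big_ind D D0 DD) => m mf.
  exact/DZ/DX/Bf.
have [N] := ubnP (m t); elim: N m => // N IH m leN Bm.
have [mb | bm] := ltnP (m t) b.
  exists 0, 'X_[m]; rewrite mul0r add0r; split=> //; first exact: supp_in0.
    exact: supp_inX.
  exact: supp_inX.
(* 'X_t ^+ b = u^-1 *: (g - low), and low has smaller degree in 'X_t. *)
pose m' := (m - U_(t) *+ b)%MM.
have leXm : (U_(t) *+ b <= m)%MM.
  by apply/mnm_lepP => s; rewrite mnmUnE; case: eqP => [<-|]; rewrite ?mul1n.
have mE : m = (m' + U_(t) *+ b)%MM by rewrite submK.
have Bm' : B m'.
  apply: Bext Bm _ => s ts; rewrite mnmBE mnmUnE.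
  by rewrite -val_eqE /= ltn_eqF // subn0.
have -> : 'X_[m] = u^-1 *: 'X_[m'] * g + (- u^-1) *: ('X_[m'] * low).
  rewrite gE mulrDr scaleNr scalerAl addrK -scalerAl -scalerAr scalerA.
  by rewrite mulVr // scale1r mE mpolyXD.
apply/(DD).
  exists (u^-1 *: 'X_[m']), 0; rewrite addr0; split=> //; try exact: supp_in0.
  by apply: supp_inZ; apply: supp_inX.
apply/(DZ); rewrite (mpolyE low) mulr_sumr big_seq; apply: (big_ind D D0 DD) =>
  m2 m2low.
rewrite -scalerAr -mpolyXD; apply/DZ; have [l2 z2] := lowP _ m2low.
have m't : (m' t = m t - b)%N by rewrite mnmBE mnmUnE eqxx mul1n.
apply: IH.
  by rewrite mnmDE m't; lia.
by apply: Bext Bm' _ => s ts; rewrite mnmDE z2 // addn0.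
Qed.

(** A monomial of q of maximal degree in 'X_t, multiplied by the leading power of
g, can be cancelled neither by the lower terms of q * g nor by r. *)
Lemma unit_lead_uniq t b g q r : unit_lead t b g ->
  supp_in (fun m => (m t < b)%N) r -> q * g + r = 0 -> q = 0.
Proof.
move=> [u [low [Uu gE lowP]]] rP qgr0.
apply: contraTeq isT => q0.
have [m0 m0q] : exists m, m \in msupp q.
  case E: (msupp q) => [|m s]; last by exists m; rewrite mem_head.
  by move/eqP: E; rewrite msupp_eq0 (negPf q0).
have [m mq mmax] : exists2 m, m \in msupp q
    & forall m', m' \in msupp q -> (m' t <= m t)%N.
  pose M := (\max_(m <- msupp q) m t)%N.
  have [m mq mM] : exists2 m, m \in msupp q & m t = M.
    rewrite /M; elim: (msupp q) m0 m0q => // a [|c s] IH m0 _.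
      by exists a; rewrite ?mem_head // big_seq1.
    have [m ms mM] := IH c (mem_head _ _).
    rewrite big_cons -mM; case: (leqP (a t) (m t)) => [am | /ltnW ma].
      by exists m; rewrite ?(maxn_idPr am) // inE ms orbT.
    by exists a; rewrite ?(maxn_idPl ma) // mem_head.
  by exists m => // m' m'q; rewrite mM; apply: leq_bigmax_seq.
have := congr1 (mcoeff (m + U_(t) *+ b)%MM) qgr0.
have tE : (m + U_(t) *+ b)%MM t = (m t + b)%N.
  by rewrite mnmDE mnmUnE eqxx mul1n.
have r_0 : r@_(m + U_(t) *+ b) = 0.
  apply/memN_msupp_eq0/negP => /rP; rewrite tE; lia.
have ql_0 : (q * low)@_(m + U_(t) *+ b) = 0.
  apply/memN_msupp_eq0/negP.
  have QL : supp_in (fun m' => (m' t < m t + b)%N) (q * low).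
    apply: supp_inM mmax lowP => m1 m2 l1 [l2 _].
    by rewrite mnmDE -addnS leq_add.
  by move/QL; rewrite tE ltnn.
rewrite gE mulrDr !mcoeffD r_0 ql_0 -scalerAr mcoeffZ mcoeff0 !addr0.
rewrite mulrC [(_ + _)%MM]addmC mcoeffMX => /eqP.
rewrite mulf_eq0 => /orP[|/eqP u0]; last by rewrite u0 unitr0 in Uu.
by rewrite mcoeff_eq0 mq.
Qed.

Lemma unit_lead_neq0 t b g : unit_lead t b g -> g != 0.
Proof.
move=> lead_g; apply/eqP => g0; have /eqP := oner_neq0 {mpoly k[n]}; apply.
apply: (unit_lead_uniq lead_g (supp_in0 _)).
by rewrite g0 mulr0 addr0.
Qed.

Variables (G : 'I_n -> {mpoly k[n]}) (b : 'I_n -> nat).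
Hypothesis leadG : forall t, unit_lead t (b t) (G t).

Definition bounded_from (j : nat) m : Prop :=
  forall t, (j <= t)%N -> (m t < b t)%N.

Lemma sum_from (j : 'I_n) (F : 'I_n -> {mpoly k[n]}) :
  \sum_(t < n | (j <= t)%N) F t = F j + \sum_(t < n | (j < t)%N) F t.
Proof.
rewrite (bigD1 j) //=; congr (_ + _); apply: eq_bigl => t.
by rewrite ltn_neqAle -val_eqE eq_sym andbC.
Qed.

Lemma sum_from_n (F : 'I_n -> {mpoly k[n]}) :
  \sum_(t < n | (n <= t)%N) F t = 0.
Proof. by rewrite big1 // => t; rewrite leqNgt ltn_ord. Qed.

Lemma downward_ind (P : nat -> Prop) :
  P n -> (forall j : 'I_n, P j.+1 -> P j) -> forall j, (j <= n)%N -> P j.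
Proof.
move=> Pn PS j jn; rewrite -(subKn jn).
elim: (n - j)%N (leq_subr j n) => [|i IH] le_in; first by rewrite subn0.
have lt_n : (n - i.+1 < n)%N by lia.
apply: (PS (Ordinal lt_n)) => /=.
rewrite (_ : (n - i.+1).+1 = n - i)%N; last by lia.
exact/IH/ltnW.
Qed.

(** Dividing by the last G first keeps the exponents already bounded: the
divisions by the earlier ones do not involve the later variables. *)
Lemma normal_form_from j : (j <= n)%N ->
  forall f, exists (q : 'I_n -> {mpoly k[n]}) r,
  [/\ f = \sum_(t < n | (j <= t)%N) q t * G t + r,
      forall t, (j <= t)%N -> supp_in (bounded_from t.+1) (q t)
    & supp_in (bounded_from j) r].
Proof.
move: j; apply: downward_ind => [f | j IH f].
  exists (fun=> 0), f; split=> [|t|m _ t]; first by rewrite sum_from_n add0r.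
    by rewrite leqNgt ltn_ord.
  by rewrite leqNgt ltn_ord.
have [q [r [fE qP rP]]] := IH f.
have Bext m m' : bounded_from j.+1 m ->
    (forall s, (j < s)%N -> m' s = m s) -> bounded_from j.+1 m'.
  by move=> Bm mm' t jt; rewrite mm' //; apply: Bm.
have [q' [r' [rE q'P r'P r'b]]] := unit_lead_div (leadG j) Bext rP.
exists (fun t => if t == j then q' else q t), r'; split=> [|t jt|m mr t].
- rewrite sum_from eqxx fE rE addrA; congr (_ + _); rewrite addrC.
  congr (_ + _); apply: eq_bigr => t jt.
  by rewrite -val_eqE /= gtn_eqF.
- case: eqVneq => [-> //|tj]; apply: qP.
  by rewrite ltn_neqAle jt andbT eq_sym.
rewrite leq_eqVlt => /orP[/eqP/val_inj <- | jt]; first exact: r'b.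
exact: r'P.
Qed.

Lemma normal_form f : exists (q : 'I_n -> {mpoly k[n]}) r,
  [/\ f = \sum_t q t * G t + r,
      forall t, supp_in (bounded_from t.+1) (q t)
    & supp_in (bounded_from 0) r].
Proof.
have [q [r [-> qP rP]]] := normal_form_from (leq0n n) f.
by exists q, r; split=> // t; apply: qP.
Qed.

(** Read from the last variable down: once the later q vanish, everything but
q t * G t has degree less than b t in 'X_t. *)
Lemma normal_form_uniq (q : 'I_n -> {mpoly k[n]}) r :
    \sum_t q t * G t + r = 0 ->
    (forall t, supp_in (bounded_from t.+1) (q t)) ->
    supp_in (bounded_from 0) r -> forall t, q t = 0.
Proof.
move=> E qP rP t.
suff: forall j, (j <= n)%N -> forall t, (j <= t)%N -> q t = 0.
  by move/(_ 0%N); apply.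
apply: downward_ind => [s | j IH]; first by rewrite leqNgt ltn_ord.
move=> s; rewrite leq_eqVlt => /orP[/eqP/val_inj <- | ]; last exact: IH.
move: E; rewrite (bigD1 j) //= -addrA.
apply: unit_lead_uniq (leadG j) _; apply: supp_inD; last first.
  by apply: supp_inW rP => m; apply.
apply: supp_in_sum => i ij; have [ji | ] := ltnP j i.
  by rewrite IH // mul0r; apply: supp_in0.
rewrite leq_eqVlt val_eqE (negPf ij) /= => lt_ij.
have [u [low [_ -> lowP]]] := leadG i.
apply: (supp_inM (P2 := fun m => m j = 0%N)) (qP i) _ => [m1 m2 B1 z2|].
  by rewrite mnmDE z2 addn0; apply: B1.
apply: supp_inD; last by apply: supp_inW lowP => m [_]; apply.
by apply: supp_inZ; apply: supp_inX; rewrite mnmUnE -val_eqE /= ltn_eqF.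
Qed.

(** The coefficient of G j may be reduced modulo the later G: the quotients are
absorbed in their coefficients. *)
Lemma ideal_normal_form (h : 'I_n -> {mpoly k[n]}) :
  exists q : 'I_n -> {mpoly k[n]},
  \sum_t h t * G t = \sum_t q t * G t
  /\ forall t, supp_in (bounded_from t.+1) (q t).
Proof.
suff: forall j, (j <= n)%N -> forall h : 'I_n -> {mpoly k[n]},
    exists q : 'I_n -> {mpoly k[n]},
    \sum_(t < n | (j <= t)%N) h t * G t = \sum_(t < n | (j <= t)%N) q t * G t
    /\ forall t, (j <= t)%N -> supp_in (bounded_from t.+1) (q t).
  move/(_ 0%N (leq0n n) h) => [q [E qP]]; exists q; split=> // t; exact: qP.
apply: downward_ind => {}h => [|IH h'].
  by exists h; split=> // t; rewrite leqNgt ltn_ord.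
have [p [r [hE pP rP]]] := normal_form_from (ltn_ord h) (h' h).
have [q [qE qP]] := IH (fun t => h' t + p t * G h).
exists (fun t => if t == h then r else q t); split=> [|t ht].
  rewrite !sum_from eqxx {1}hE mulrDl addrAC addrC; congr (_ + _).
  under [RHS]eq_bigr => t ht.
    rewrite -val_eqE /= gtn_eqF //; over.
  rewrite -qE mulr_suml -big_split /=; apply: eq_bigr => t _.
  by rewrite mulrDl addrC mulrAC.
case: eqVneq => [-> //|th]; apply: qP.
by rewrite ltn_neqAle ht andbT eq_sym.
Qed.

Lemma ideal_normal_eq0 (h : 'I_n -> {mpoly k[n]}) :
  supp_in (bounded_from 0) (\sum_t h t * G t) -> \sum_t h t * G t = 0.
Proof.
have [q [-> qP]] := ideal_normal_form h => fP.
rewrite big1 // => t _; rewrite (normal_form_uniq _ qP (supp_inN fP)) ?mul0r //.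
exact: subrr.
Qed.

End TriangularFamilies.

(** * Reduced words of permutations *)

(** Inner equality tests come first, so that no test is left with a conditional
on its left-hand side. *)
Ltac split_tests := repeat match goal with
  |- context [?x == ?y] =>
    lazymatch x with
    | context [if _ then _ else _] => fail
    | _ => case: (x =P y) => ?
    end
  end.

Section ReducedWords.
Variable n : nat.
Implicit Types (l : 'I_n) (s : seq 'I_n) (w v : 'S_n.+1) (a b : 'I_n.+1).
Local Notation "@@ l" := (inord l : 'I_n.+1) (at level 8, format "@@ l").

Lemma val_lo l : @@l = l :> nat.
Proof. by rewrite inordK // ltnS ltnW. Qed.

Lemma val_hi l : @@l.+1 = l.+1 :> nat.
Proof. by rewrite inordK // ltnS. Qed.

Lemma lo_neq_hi l : @@l != @@l.+1.
Proof. by rewrite -val_eqE /= val_lo val_hi; lia. Qed.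

Lemma adjtr_lo l : adjtr n l @@l = @@l.+1.
Proof. exact: tpermL. Qed.

Lemma adjtr_hi l : adjtr n l @@l.+1 = @@l.
Proof. exact: tpermR. Qed.

Lemma adjtrE l a : adjtr n l a = (if a == l :> nat then l.+1
  else if a == l.+1 :> nat then l : nat else a) :> nat.
Proof.
rewrite /adjtr; case: tpermP => [->|->|].
- by rewrite val_lo eqxx val_hi.
- by rewrite val_hi val_lo eqxx; case: eqP => //; lia.
move=> /eqP + /eqP; rewrite -!val_eqE /= val_lo val_hi.
by move=> /negPf -> /negPf ->.
Qed.

Lemma adjtrK l : (adjtr n l * adjtr n l = 1)%g.
Proof. exact: tperm2. Qed.

Lemma adjtrV l : ((adjtr n l)^-1 = adjtr n l)%g.
Proof. exact: tpermV. Qed.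

Lemma adjtr_involutive l : involutive (adjtr n l).
Proof. exact: tpermK. Qed.

Lemma adjtr_comm l l' : (l.+1 < l')%N || (l'.+1 < l)%N ->
  (adjtr n l * adjtr n l' = adjtr n l' * adjtr n l)%g.
Proof.
move=> far; apply/permP => a; apply/val_inj; rewrite !permM /= !adjtrE.
by split_tests; lia.
Qed.

Lemma adjtr_braid l l' : l' = l.+1 :> nat ->
  (adjtr n l * adjtr n l' * adjtr n l = adjtr n l' * adjtr n l * adjtr n l')%g.
Proof.
move=> ll'; apply/permP => a; apply/val_inj; rewrite !permM /= !adjtrE.
by split_tests; lia.
Qed.

Lemma word_perm0 : word_perm [::] = 1%g :> 'S_n.+1.
Proof. by rewrite /word_perm big_nil. Qed.

Lemma word_perm_cons l s : word_perm (l :: s) = (word_perm s * adjtr n l)%g.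
Proof. by rewrite /word_perm rev_cons -cats1 big_cat big_seq1. Qed.

Lemma word_perm_rcons l s : word_perm (rcons s l) = (adjtr n l * word_perm s)%g.
Proof. by rewrite /word_perm rev_rcons big_cons. Qed.

Definition inversions w : {set 'I_n.+1 * 'I_n.+1} :=
  [set p : 'I_n.+1 * 'I_n.+1 | (p.1 < p.2)%N && (w p.2 < w p.1)%N].

(** The Coxeter length, as the number of inversions. *)
Definition perm_length w : nat := #|inversions w|.

(** w * adjtr n l, which is adjtr n l after w as a map, is longer than w. *)
Definition ascent w l : bool := ((w^-1)%g @@l < (w^-1)%g @@l.+1)%N.

Lemma ascent_adjtr w l : ascent (w * adjtr n l) l = ~~ ascent w l.
Proof.
rewrite /ascent invMg !permM adjtrV adjtr_lo adjtr_hi -leqNgt [RHS]leq_eqVlt.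
by rewrite val_eqE (inj_eq perm_inj) eq_sym (negPf (lo_neq_hi l)).
Qed.

(** Exchanging the values l and l + 1 changes the relative order of one pair
only, the pair of their preimages. *)
Lemma perm_length_ascent w l :
  ascent w l -> perm_length (w * adjtr n l) = (perm_length w).+1.
Proof.
set p := (w^-1)%g @@l; set q := (w^-1)%g @@l.+1; move=> pq.
have pq' : (p < q)%N by [].
have wp : w p = @@l by rewrite permKV.
have wq : w q = @@l.+1 by rewrite permKV.
have -> : perm_length (w * adjtr n l) = #|(p, q) |: inversions w|.
  apply: eq_card => -[a b]; rewrite !inE /= xpair_eqE !permM !adjtrE.
  have ap : (w a == l :> nat) = (a == p).
    by rewrite -(val_lo l) val_eqE -wp (inj_eq perm_inj).
  have bp : (w b == l :> nat) = (b == p).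
    by rewrite -(val_lo l) val_eqE -wp (inj_eq perm_inj).
  have aq : (w a == l.+1 :> nat) = (a == q).
    by rewrite -(val_hi l) val_eqE -wq (inj_eq perm_inj).
  have bq : (w b == l.+1 :> nat) = (b == q).
    by rewrite -(val_hi l) val_eqE -wq (inj_eq perm_inj).
  have nqp : (q == p) = false by apply/negP => /eqP E; move: pq'; rewrite E ltnn.
  rewrite ap aq bp bq.
  have [->|nap] := eqVneq a p; have [->|nbp] := eqVneq b p.
  - by rewrite (eq_sym p) nqp !ltnn.
  - have [->|nbq] := eqVneq b q; rewrite /= ?pq' /=; first by lia.
    rewrite wp val_lo; congr (_ && _); move: nbp nbq; rewrite -bp -bq; lia.
  - rewrite (eq_sym p) nqp; have [->|naq] := eqVneq a q; rewrite /=.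
      by rewrite wp val_lo wq val_hi; lia.
    rewrite wp val_lo; congr (_ && _); move: nap naq; rewrite -ap -aq; lia.
  have [->|naq] := eqVneq a q; have [->|nbq] := eqVneq b q => //=.
  - by rewrite !ltnn.
  - rewrite wq val_hi; congr (_ && _); move: nbp nbq; rewrite -bp -bq; lia.
  rewrite wq val_hi; congr (_ && _); move: nap naq; rewrite -ap -aq; lia.
rewrite cardsU1 !inE /= wp wq val_lo val_hi pq' /=.
by rewrite ltnNge leqnSn.
Qed.

Lemma perm_length_descent w l :
  ~~ ascent w l -> perm_length w = (perm_length (w * adjtr n l)).+1.
Proof.
by rewrite -ascent_adjtr => /perm_length_ascent; rewrite -mulgA adjtrK mulg1.
Qed.

Lemma perm_length1 : perm_length 1 = 0%N.
Proof.
apply/eqP; rewrite cards_eq0; apply/eqP/setP => -[a b]; rewrite !inE !perm1 /=.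
by case: ltngtP.
Qed.

Lemma perm_lengthV w : perm_length w^-1 = perm_length w.
Proof.
rewrite /perm_length.
pose F (p : 'I_n.+1 * 'I_n.+1) := ((w^-1)%g p.2, (w^-1)%g p.1).
have Finj : injective F by move=> [a b] [c d] [/perm_inj -> /perm_inj ->].
rewrite -(card_imset _ Finj); apply: eq_card => -[a b].
apply/imsetP/idP => [[[c d]] | ]; rewrite !inE /=.
  by move=> /andP[cd ab] [-> ->]; rewrite !permKV ab.
move=> /andP[ab ba]; exists (w b, w a); last by rewrite /F /= !permK.
by rewrite inE /= !permK ab ba.
Qed.

Lemma all_ascents w : (forall l, ascent w l) -> w = 1%g.
Proof.
move=> asc; set f := (w^-1)%g.
suff f1 : f = 1%g by rewrite -(invgK w) -/f f1 invg1.
have step i : (i < n)%N -> (f (inord i) < f (inord i.+1))%N.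
  by move=> lt_in; apply: (asc (Ordinal lt_in)).
have up i : (i <= n)%N -> (i <= f (inord i))%N.
  elim: i => // i IH lt_in.
  exact: leq_ltn_trans (IH (ltnW lt_in)) (step _ lt_in).
have down i : (i <= n)%N -> (f (inord (n - i)) <= n - i)%N.
  elim: i => [_|i IH lt_in]; first by rewrite subn0 -ltnS.
  have := IH (ltnW lt_in); have := @step (n - i.+1)%N.
  rewrite (_ : (n - i.+1).+1 = n - i)%N; lia.
apply/permP => a; apply/val_inj; rewrite perm1 /=.
have le_an : (a <= n)%N by rewrite -ltnS.
have := up _ le_an; have := down _ (leq_subr a n).
rewrite subKn // inord_val => le_a ge_a; apply/eqP.
by rewrite eqn_leq le_a.
Qed.

(** Minimality of the word, in the computable form given by the length. *)
Definition reduced s : bool := size s == perm_length (word_perm s).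

Lemma perm_length_word s : (perm_length (word_perm s) <= size s)%N.
Proof.
elim: s => [|l s IH] /=; first by rewrite word_perm0 perm_length1.
rewrite word_perm_cons; have [/perm_length_ascent -> //|] :=
  boolP (ascent (word_perm s) l).
by move=> /perm_length_descent E; rewrite E in IH; lia.
Qed.

Lemma reduced_cons l s :
  reduced (l :: s) = reduced s && ascent (word_perm s) l.
Proof.
rewrite /reduced word_perm_cons /=; have := perm_length_word s.
have [/perm_length_ascent ->|/perm_length_descent ->] :=
  boolP (ascent (word_perm s) l); first by rewrite andbT eqSS.
rewrite andbF => le_s; apply/negbTE; lia.
Qed.

Lemma exists_reduced w : exists2 s, reduced s & word_perm s = w.
Proof.
have [N] := ubnP (perm_length w); elim: N w => // N IH w.
have [/forallP/all_ascents -> _|] := boolP [forall l, ascent w l].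
  by exists [::]; rewrite /reduced word_perm0 ?perm_length1.
rewrite negb_forall => /existsP[l /[dup] des /perm_length_descent ->] lt_N.
have [s red_s ws] := IH (w * adjtr n l)%g ltac:(lia).
exists (l :: s); last by rewrite word_perm_cons ws -mulgA adjtrK mulg1.
by rewrite reduced_cons red_s ws ascent_adjtr.
Qed.

Lemma reduced_exprP w s :
  reduced_expr w s -> reduced s /\ word_perm s = w.
Proof.
move=> [<- smin]; split=> //; have [t /eqP len_t wt] := exists_reduced
  (word_perm s).
by rewrite /reduced eqn_leq perm_length_word andbT -wt -len_t smin.
Qed.

Lemma reduced_descent w l s :
  ~~ ascent w l -> reduced s -> word_perm s = (w * adjtr n l)%g ->
  reduced (l :: s) /\ word_perm (l :: s) = w.
Proof.
move=> des red_s ws; rewrite reduced_cons red_s word_perm_cons ws.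
by rewrite -mulgA adjtrK mulg1 ascent_adjtr.
Qed.

Lemma reduced_consP l s : reduced (l :: s) -> [/\ reduced s,
  word_perm s = (word_perm (l :: s) * adjtr n l)%g
  & ~~ ascent (word_perm (l :: s)) l].
Proof.
rewrite reduced_cons word_perm_cons => /andP[red_s asc]; split=> //.
  by rewrite -mulgA adjtrK mulg1.
by rewrite ascent_adjtr negbK.
Qed.

Section Matsumoto.
Variables (A : pzRingType) (T : 'I_n -> A).
Hypothesis Tcomm : forall l l', (l.+1 < l')%N || (l'.+1 < l)%N ->
  T l * T l' = T l' * T l.
Hypothesis Tbraid : forall l l', l' = l.+1 :> nat ->
  T l' * T l * T l' = T l * T l' * T l.

Let prodT s := \prod_(l <- s) T l.

Lemma ascent_far w l l' : (l.+1 < l')%N || (l'.+1 < l)%N ->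
  ascent (w * adjtr n l) l' = ascent w l'.
Proof.
move=> far; rewrite /ascent invMg !permM adjtrV.
have E a : (a : nat) != l -> (a : nat) != l.+1 -> adjtr n l a = a.
  by move=> al al'; apply/val_inj; rewrite /= adjtrE (negPf al) (negPf al').
by rewrite !E ?val_lo ?val_hi //; lia.
Qed.

Lemma ascent_next w l l' : l' = l.+1 :> nat \/ l = l'.+1 :> nat ->
  ~~ ascent w l -> ~~ ascent w l' -> ~~ ascent (w * adjtr n l) l' /\
  ~~ ascent (w * adjtr n l * adjtr n l') l.
Proof.
move=> adj; rewrite /ascent !invMg !permM !adjtrV.
case: adj => adj.
  have -> : @@l' = @@l.+1 by rewrite adj.
  have -> : adjtr n l @@l'.+1 = @@l'.+1.
    by apply/val_inj; rewrite /= adjtrE val_hi; split_tests; lia.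
  have -> : adjtr n l' @@l = @@l.
    by apply/val_inj; rewrite /= adjtrE val_lo; split_tests; lia.
  have -> : adjtr n l' @@l.+1 = @@l'.+1 by rewrite -adj adjtr_lo.
  have -> : adjtr n l @@l'.+1 = @@l'.+1.
    by apply/val_inj; rewrite /= adjtrE val_hi; split_tests; lia.
  by rewrite adjtr_lo adjtr_hi -!leqNgt => h1 h2; split=> //; apply:
    leq_trans h2 h1.
have -> : @@l = @@l'.+1 by rewrite adj.
have -> : adjtr n l @@l' = @@l'.
  by apply/val_inj; rewrite /= adjtrE val_lo; split_tests; lia.
have -> : adjtr n l @@l'.+1 = @@l.+1 by rewrite -adj adjtr_lo.
have -> : adjtr n l' @@l.+1 = @@l.+1.
  by apply/val_inj; rewrite /= adjtrE val_hi; split_tests; lia.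
have -> : adjtr n l @@l.+1 = @@l'.+1 by rewrite adjtr_hi adj.
have -> : adjtr n l' @@l'.+1 = @@l' by exact: adjtr_hi.
have -> : adjtr n l @@l' = @@l'.
  by apply/val_inj; rewrite /= adjtrE val_lo; split_tests; lia.
by rewrite -!leqNgt => h1 h2; split=> //; apply: leq_trans h1 h2.
Qed.

(** Induction on the length. If the two words start with distinct letters i and
j, both are descents, so there are reduced words starting with the longest
element of the group generated by i and j, written in either order; these
agree by the braid relation, and the induction hypothesis applies below. *)
Theorem matsumoto s t : reduced s -> reduced t ->
  word_perm s = word_perm t -> prodT s = prodT t.
Proof.
have [N] := ubnP (size s); elim: N s t => // N IH s t lt_N red_s red_t wst.
have sz : size s = size t by rewrite (eqP red_s) (eqP red_t) wst.
case: s t => [|i s'] [|j t'] //= in lt_N sz red_s red_t wst *.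
have [red_s' ws' des_i] := reduced_consP red_s.
have [red_t' wt' des_j] := reduced_consP red_t.
rewrite -wst in wt' des_j; set w := word_perm (i :: s') in ws' wt' des_i des_j *.
rewrite /prodT !big_cons.
have [ij|ij] := eqVneq i j.
  by rewrite -ij in wt' *; congr (_ * _); apply: IH => //; rewrite ws' wt'.
have IHs r : reduced r -> word_perm r = word_perm s' -> prodT s' = prodT r.
  by move=> red_r wr; apply: IH.
have IHt r : reduced r -> word_perm r = word_perm t' -> prodT t' = prodT r.
  by move=> red_r wr; apply: IH => //; move: sz lt_N => [->].
have [far|near] := boolP ((i.+1 < j)%N || (j.+1 < i)%N).
  have far' : (j.+1 < i)%N || (i.+1 < j)%N by rewrite orbC.
  have [r red_r wr] := exists_reduced (w * adjtr n i * adjtr n j)%g.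
  have des_j' : ~~ ascent (w * adjtr n i) j by rewrite ascent_far.
  have [red1 w1] := reduced_descent des_j' red_r wr.
  have des_i' : ~~ ascent (w * adjtr n j) i by rewrite ascent_far.
  have wr' : word_perm r = (w * adjtr n j * adjtr n i)%g.
    by rewrite wr -!mulgA (adjtr_comm far).
  have [red2 w2] := reduced_descent des_i' red_r wr'.
  rewrite [\prod_(l <- s') _](IHs (j :: r)) ?w1 //.
  rewrite [\prod_(l <- t') _](IHt (i :: r)) ?w2 //.
  by rewrite /prodT !big_cons !mulrA Tcomm.
have adj : j = i.+1 :> nat \/ i = j.+1 :> nat.
  by move: near ij; rewrite -val_eqE /=; lia.
have adj' : i = j.+1 :> nat \/ j = i.+1 :> nat by case: adj; [right | left].
have [des1 des2] := ascent_next adj des_i des_j.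
have [des3 des4] := ascent_next adj' des_j des_i.
have [r red_r wr] := exists_reduced (w * adjtr n i * adjtr n j * adjtr n i)%g.
have [red1 w1] := reduced_descent des2 red_r wr.
have [red2 w2] := reduced_descent des1 red1 w1.
have wr' : word_perm r = (w * adjtr n j * adjtr n i * adjtr n j)%g.
  rewrite wr -!mulgA; congr (_ * _)%g; rewrite !mulgA.
  by case: adj => adj; [rewrite (adjtr_braid adj) | rewrite -(adjtr_braid adj)].
have [red3 w3] := reduced_descent des4 red_r wr'.
have [red4 w4] := reduced_descent des3 red3 w3.
rewrite [\prod_(l <- s') _](IHs [:: j, i & r]) ?w2 //.
rewrite [\prod_(l <- t') _](IHt [:: i, j & r]) ?w4 //.
rewrite /prodT !big_cons !mulrA.
by case: adj => adj; rewrite (Tbraid adj).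
Qed.

End Matsumoto.
End ReducedWords.

(** * Free algebras, quotients and evaluation of polynomials *)

HB.instance Definition _ (k : pzRingType) (A : pzAlgType k) :=
  GRing.isZmodMorphism.Build k A (@algc k A) algcB.
HB.instance Definition _ (k : pzRingType) (A : pzAlgType k) :=
  GRing.isMonoidMorphism.Build k A (@algc k A) algcM.

(** The shapes of the KLR relations, for arbitrary elements. *)
Section MorphismOfCommutators.
Variables (A B : pzRingType) (f : {rmorphism A -> B}).

Lemma rmorph_comm2 u v u' v' r : f ((u * v - u' * v') * r)
  = (f u * f v - f u' * f v') * f r.
Proof. by rewrite rmorphM rmorphB !rmorphM. Qed.

Lemma rmorph_comm3 u v t u' v' t' r : f ((u * v * t - u' * v' * t') * r)
  = (f u * f v * f t - f u' * f v' * f t') * f r.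
Proof. by rewrite rmorphM rmorphB !rmorphM. Qed.

Lemma rmorphMM u v t : f (u * v * t) = f u * f v * f t.
Proof. by rewrite !rmorphM. Qed.

End MorphismOfCommutators.

Section QuotientMorphism.
Variables (k : pzRingType) (A : pzAlgType k) (X : A -> Prop).

Lemma to_quot_zmod : zmod_morphism (@to_quot k A X).
Proof.
move=> u v; apply: (addIr (to_quot X v)).
by rewrite -to_quotD !subrK.
Qed.
Lemma to_quot_monoid : monoid_morphism (@to_quot k A X).
Proof. by split=> // u v; apply: to_quotM. Qed.
HB.instance Definition _ :=
  GRing.isZmodMorphism.Build A (alg_quot X) (@to_quot k A X) to_quot_zmod.
HB.instance Definition _ :=
  GRing.isMonoidMorphism.Build A (alg_quot X) (@to_quot k A X) to_quot_monoid.

Lemma to_quot_surj p : exists u, p = to_quot X u.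
Proof. by exists (repr p); rewrite /to_quot reprK. Qed.

Lemma to_quot_eq0 u : to_quot X u = 0 <-> ideal_gen X u.
Proof. by rewrite -(rmorph0 (@to_quot k A X)) to_quotP subr0. Qed.

Lemma to_quotZ c u : to_quot X (algc c * u) = c *: to_quot X u.
Proof. by rewrite to_quotM. Qed.

Lemma to_quot_sumZ (J : Type) (s : seq J) (c : J -> k) (u : J -> A) :
  to_quot X (\sum_(j <- s) algc (c j) * u j) = \sum_(j <- s) c j *: to_quot X (u j).
Proof. by rewrite rmorph_sum; apply: eq_bigr => j _; rewrite /= to_quotZ. Qed.

End QuotientMorphism.

Section FreeAlgebraMap.
Import finmap monalg.
Variables (k : comNzRingType) (G : choiceType) (A : pzRingType).
Variables (c : {rmorphism k -> A}) (h : G -> A).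
Hypothesis c_central : forall a u, c a * u = u * c a.

(** The universal property of the free algebra; the target may be the zero
ring. *)
Definition free_map (u : free_alg k G) : A :=
  \sum_(m <- msupp u) c (mcoeff m u) * \prod_(g <- fmonom_val m) h g.

Lemma free_map_sup (d : {fset {fmonom G}}) u : (msupp u `<=` d)%fset ->
  free_map u = \sum_(m <- d) c (mcoeff m u) * \prod_(g <- fmonom_val m) h g.
Proof.
move=> le; rewrite /free_map (big_fset_incl _ le) //= => x xd /mcoeff_outdom ->.
by rewrite raddf0 mul0r.
Qed.

Lemma free_map_zmod : zmod_morphism free_map.
Proof.
move=> u v /=; have le_u := fsubsetUl (msupp u) (msupp v).
have le_v := fsubsetUr (msupp u) (msupp v).
have le_uv : (msupp (u - v) `<=` msupp u `|` msupp v)%fset.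
  by apply: fsubset_trans (msuppD_le _ _) _; rewrite msuppN.
rewrite (free_map_sup le_u) (free_map_sup le_v) (free_map_sup le_uv) -sumrB.
by apply: eq_bigr => m _; rewrite !raddfB /= mulrBl.
Qed.

Lemma free_map0 : free_map 0 = 0.
Proof. by rewrite -(subrr 0) free_map_zmod subrr. Qed.

Lemma free_mapD u v : free_map (u + v) = free_map u + free_map v.
Proof. by rewrite -{1}[v]opprK -[- v]sub0r !free_map_zmod free_map0 sub0r
  opprK. Qed.

Lemma free_mapU (a : k) (m : {fmonom G}) :
  free_map << a *g m >> = c a * \prod_(g <- fmonom_val m) h g.
Proof.
by rewrite (free_map_sup (d := [fset m]%fset)) ?msuppU_le // big_seq_fset1 mcoeffUU.
Qed.

Lemma free_map_monoid : monoid_morphism free_map.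
Proof.
split=> [|u v]; first by rewrite free_mapU rmorph1 mul1r fm1 big_nil.
rewrite [u * v]malgME (big_morph _ free_mapD free_map0) {2}/free_map mulr_suml /=.
apply: eq_bigr => m1 _.
rewrite (big_morph _ free_mapD free_map0) {2}/free_map mulr_sumr /=.
apply: eq_bigr => m2 _; rewrite free_mapU rmorphM fmM big_cat /=.
by rewrite -!mulrA; congr (_ * _); rewrite !mulrA c_central.
Qed.

Lemma free_map_algc a : free_map (algc a) = c a.
Proof.
have -> : algc a = << a *g mone >> :> free_alg k G by [].
by rewrite free_mapU fm1 big_nil mulr1.
Qed.

Lemma free_map_gen g : free_map (free_gen k g) = h g.
Proof. by rewrite free_mapU rmorph1 mul1r fmU big_seq1. Qed.

Lemma free_alg_ind (P : free_alg k G -> Prop) :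
    P 0 -> P 1 -> (forall u v, P u -> P v -> P (u + v)) ->
    (forall a u, P u -> P (algc a * u)) ->
    (forall g u, P u -> P (free_gen k g * u)) -> forall u, P u.
Proof.
move=> P0 P1 PD PZ PG u; rewrite [u]monalgE; apply: big_ind => // m _.
have -> : << mcoeff m u *g m >>
    = (algc (mcoeff m u) : free_alg k G) * (<< m >> : free_alg k G).
  by rewrite [RHS]fgmulUU mulr1 mul1m.
apply: PZ; rewrite -[m]fmK; elim: (fmonom_val m) => [|g s IH].
  by have -> : << FMonom [::] >> = 1 :> free_alg k G by rewrite -fmoneE.
have -> : << FMonom (g :: s) >> = free_gen k g * << FMonom s >> :> free_alg k G.
  by rewrite [RHS]fgmulUU mulr1 -[mmul _ _]/(fmmul _ _) fmmulE fmuE.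
exact: PG.
Qed.

End FreeAlgebraMap.

Section QuotientMap.
Variables (k : pzRingType) (A : pzAlgType k) (X : A -> Prop).
Variables (B : pzRingType) (f : {rmorphism A -> B}).
Hypothesis fX : forall r, X r -> f r = 0.

Definition quot_map (p : alg_quot X) : B := f (repr p).

Lemma quot_mapE u : quot_map (to_quot X u) = f u.
Proof.
apply/eqP; rewrite -subr_eq0 -rmorphB; apply/eqP.
elim: (repr_pi X u) => [|a r b v Xr _ IH]; first by rewrite rmorph0.
by rewrite rmorphD !rmorphM (fX Xr) mulr0 mul0r add0r.
Qed.

Lemma quot_map_zmod : zmod_morphism quot_map.
Proof.
move=> p q; have [u ->] := to_quot_surj p; have [v ->] := to_quot_surj q.
by rewrite -rmorphB !quot_mapE rmorphB.
Qed.

Lemma quot_map_monoid : monoid_morphism quot_map.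
Proof.
split=> [|p q]; first by rewrite -(rmorph1 (to_quot X)) quot_mapE rmorph1.
have [u ->] := to_quot_surj p; have [v ->] := to_quot_surj q.
by rewrite -rmorphM !quot_mapE rmorphM.
Qed.

End QuotientMap.

Section PolynomialEvaluation.
Variables (k : comNzRingType) (A : pzAlgType k) (n : nat) (x : 'I_n -> A).
Implicit Types (p q : {mpoly k[n]}) (m : 'X_{1..n}).

Lemma xpol_sup (s : seq 'X_{1..n}) p : uniq s -> {subset msupp p <= s} ->
  xpol x p = \sum_(m <- s) algc p@_m * xmon x m.
Proof.
move=> us sub; rewrite (bigID (mem (msupp p))) /= [X in _ + X]big1 ?addr0.
  rewrite -big_filter; apply: perm_big; apply: uniq_perm => //.
    exact: filter_uniq.
  by move=> m; rewrite mem_filter; case mp: (m \in msupp p) => //=; rewrite sub.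
by move=> m /memN_msupp_eq0 ->; rewrite rmorph0 mul0r.
Qed.

Lemma xpol_zmod : zmod_morphism (xpol x).
Proof.
move=> p q; pose s := undup (msupp p ++ msupp q).
have sp : {subset msupp p <= s} by move=> m mp; rewrite mem_undup mem_cat mp.
have sq : {subset msupp q <= s}.
  by move=> m mq; rewrite mem_undup mem_cat mq orbT.
have spq : {subset msupp (p - q) <= s}.
  by move=> m /msuppB_le; rewrite mem_undup.
rewrite !(xpol_sup (undup_uniq _) _ : xpol x _ = \sum_(m <- s) _) // -sumrB.
by apply: eq_bigr => m _; rewrite mcoeffB rmorphB mulrBl.
Qed.
HB.instance Definition _ :=
  GRing.isZmodMorphism.Build {mpoly k[n]} A (xpol x) xpol_zmod.

Lemma xpolZ c p : xpol x (c *: p) = algc c * xpol x p.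
Proof.
rewrite (xpol_sup (msupp_uniq p)); last by move=> m /msuppZ_le.
by rewrite /xpol mulr_sumr; apply: eq_bigr => m _; rewrite mcoeffZ rmorphM mulrA.
Qed.

Lemma xpol_mon m : xpol x 'X_[m] = xmon x m.
Proof. by rewrite /xpol msuppX big_seq1 mcoeffX eqxx rmorph1 mul1r. Qed.

Lemma xmon0 : xmon x 0%MM = 1.
Proof. by rewrite /xmon big1 // => i _; rewrite mnm0E expr0. Qed.

Lemma xpol1 : xpol x 1 = 1.
Proof. by rewrite -mpolyX0 xpol_mon xmon0. Qed.

Lemma xmonU i : xmon x U_(i)%MM = x i.
Proof.
suff E (s : seq 'I_n) : uniq s ->
    \prod_(j <- s) x j ^+ U_(i)%MM j = if i \in s then x i else 1.
  by rewrite /xmon (E (index_enum _)) ?index_enum_uniq // mem_index_enum.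
elim: s => [|j s IH] /=; first by rewrite big_nil.
move=> /andP[js us]; rewrite big_cons IH // mnm1E inE.
have [ij|ij] := eqVneq i j; last by rewrite mul1r.
by rewrite ij (negPf js) mulr1.
Qed.

Lemma xpolXi i : xpol x 'X_i = x i.
Proof. by rewrite xpol_mon xmonU. Qed.

Lemma xpol_intertwine (y : 'I_n -> A) (u : A) p :
  (forall i, u * x i = y i * u) -> u * xpol x p = xpol y p * u.
Proof.
move=> ux; rewrite /xpol mulr_sumr mulr_suml; apply: eq_bigr => m _.
rewrite mulrA -algcC -!mulrA; congr (_ * _).
rewrite /xmon; elim: (index_enum _) => [|i s IH].
  by rewrite !big_nil mul1r mulr1.
rewrite !big_cons mulrA -[RHS]mulrA -IH [RHS]mulrA; congr (_ * _).
elim: (m i) => [|d IHd]; first by rewrite !expr0 mul1r mulr1.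
by rewrite !exprS mulrA ux -!mulrA IHd.
Qed.

Hypothesis xC : forall i j, x i * x j = x j * x i.

Lemma xmonD m1 m2 : xmon x (m1 + m2)%MM = xmon x m1 * xmon x m2.
Proof.
rewrite /xmon; elim: (index_enum _) => [|i s IH]; first by rewrite !big_nil mulr1.
rewrite !big_cons IH mnmDE exprD -!mulrA; congr (_ * _).
rewrite !mulrA; congr (_ * _).
suff C : GRing.comm (\prod_(j <- s) x j ^+ m1 j) (x i ^+ m2 i) by [].
apply: commrX; apply: commr_sym; elim: (s) => [|j s' IHs].
  by rewrite big_nil; apply: commr1.
by rewrite big_cons; apply: commrM => //; apply: commrX; apply: xC.
Qed.

Lemma xpolM p q : xpol x (p * q) = xpol x p * xpol x q.
Proof.
rewrite {1}(mpolyE p) {1}(mpolyE q) mulr_suml raddf_sum /= mulr_suml.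
apply: eq_bigr => m1 _; rewrite mulr_sumr raddf_sum /= mulr_sumr.
apply: eq_bigr => m2 _; rewrite -scalerAl -scalerAr !xpolZ -mpolyXD xpol_mon xmonD.
by rewrite -!mulrA; congr (_ * _); rewrite !mulrA algcC.
Qed.

Lemma xpol_msym (w : 'S_n) p : xpol x (msym w p) = xpol (x \o w) p.
Proof.
rewrite {1}(mpolyE p) (raddf_sum (msym w)) raddf_sum /= [RHS]/xpol.
apply: eq_bigr => m _.
rewrite msymZ xpolZ msymX xpol_mon; congr (_ * _).
have -> : [multinom m ((w^-1)%g i) | i < n] = (\sum_(i < n) U_(w i) *+ m i)%MM.
  apply/mnmP => j; rewrite mnmE mnm_sumE (bigD1 ((w^-1)%g j)) //= mulmnE mnm1E.
  rewrite permKV eqxx mul1n big1 ?addn0 // => i ij.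
  rewrite mulmnE mnm1E; case: eqP => [wi|]; last by rewrite mul0n.
  by rewrite -wi permK eqxx in ij.
rewrite /(xmon (x \o w)) /=; elim: (index_enum _) => [|i s IH].
  by rewrite !big_nil xmon0.
rewrite !big_cons xmonD IH; congr (_ * _).
elim: (m i) => [|d IHd]; first by rewrite mulm0n xmon0 expr0.
by rewrite mulmS xmonD xmonU IHd exprS.
Qed.

End PolynomialEvaluation.

Lemma xpol_morph (k : comNzRingType) (A B : pzAlgType k) (n : nat)
    (x : 'I_n -> A) (f : {rmorphism A -> B}) p :
  (forall c, f (algc c) = algc c) -> f (xpol x p) = xpol (f \o x) p.
Proof.
move=> fc; rewrite /xpol rmorph_sum; apply: eq_bigr => m _.
rewrite rmorphM fc rmorph_prod; congr (_ * _); apply: eq_bigr => i _.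
by rewrite rmorphXn.
Qed.

Lemma eq_xpol (k : comNzRingType) (A : pzAlgType k) (n : nat)
    (x y : 'I_n -> A) p : x =1 y -> xpol x p = xpol y p.
Proof.
move=> xy; apply: eq_bigr => m _; congr (_ * _); apply: eq_bigr => i _.
by rewrite xy.
Qed.

(** * Arrangements of distinct colours *)

Section Arrangements.
Variables (C : cartan_datum) (n : nat) (beta : weight_lattice C).
Implicit Types (nu mu : iseq n beta) (w v : 'S_n.+1) (l : 'I_n).

Lemma iseq_inj nu mu : nu =1 mu -> nu = mu.
Proof. by move=> E; apply/val_inj/ffunP. Qed.

Lemma iseq_actE w nu t : iseq_act w nu t = nu ((w^-1)%g t).
Proof. by rewrite /iseq_act /iseq_fun /= ffunE. Qed.

Lemma iseq_act1 nu : iseq_act 1 nu = nu.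
Proof. by apply: iseq_inj => t; rewrite iseq_actE invg1 perm1. Qed.

Lemma iseq_actM w v nu : iseq_act (w * v) nu = iseq_act v (iseq_act w nu).
Proof. by apply: iseq_inj => t; rewrite !iseq_actE invMg permM. Qed.

Lemma iseq_act_adjtrK l nu : iseq_act (adjtr n l) (iseq_act (adjtr n l) nu) = nu.
Proof. by rewrite -iseq_actM adjtrK iseq_act1. Qed.

End Arrangements.

Section ColourCount.
Variables (C : cartan_datum) (n : nat) (i_ : 'I_n.+1 -> C) (hi : injective i_).
Variables (beta : weight_lattice C) (hbeta : beta = \sum_t simple_root (i_ t)).
Implicit Types nu : iseq n beta.

Lemma sum_roots (f : 'I_n.+1 -> C) :
  \sum_t simple_root (f t) = \sum_c simple_root c *~ #|[set t | f t == c]|%:Z.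
Proof.
rewrite (partition_big f predT) //=; apply: eq_bigr => c _.
rewrite (eq_bigr (fun=> simple_root c)) => [|t /eqP -> //].
by rewrite sumr_const -pmulrn; congr (_ *+ _); apply: eq_card => t; rewrite !inE.
Qed.

(** The simple roots are linearly independent, so beta determines how often each
colour occurs. *)
Lemma iseq_multiplicity nu c : #|[set t | nu t == c]| = #|[set t | i_ t == c]|.
Proof.
have /eqP : \sum_t simple_root (nu t) = \sum_t simple_root (i_ t).
  by rewrite -hbeta; apply/eqP: (valP nu).
rewrite !sum_roots -subr_eq0 -sumrB.
under eq_bigr => d _ do rewrite -mulrzBr.
move=> /eqP/root_free/(_ c)/eqP; rewrite subr_eq0 => /eqP; lia.
Qed.

Lemma iseq_colouring nu : exists p : 'S_n.+1, [forall t, nu t == i_ (p t)].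
Proof.
have colourable t : exists c, i_ c == nu t.
  have : (0 < #|[set s | nu s == nu t]|)%N.
    by apply/card_gt0P; exists t; rewrite inE.
  by rewrite iseq_multiplicity => /card_gt0P[c]; rewrite inE; exists c.
pose f t := xchoose (colourable t).
have fE t : i_ (f t) = nu t by apply/eqP/(xchooseP (colourable t)).
have f_inj : injective f.
  move=> s t fst; have nust : nu s = nu t by rewrite -!fE fst.
  have : (#|[set r | nu r == nu t]| <= 1)%N.
    rewrite iseq_multiplicity -(cards1 (f t)) subset_leq_card //.
    by apply/subsetP => r; rewrite !inE -fE (inj_eq hi).
  by move=> /card_le1P/(_ s); rewrite inE nust eqxx => /(_ isT t);
     rewrite !inE eqxx => /esym/eqP.
by exists (perm f_inj); apply/forallP => t; rewrite permE fE.
Qed.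

Lemma iseq_colour_map : exists col : iseq n beta -> 'S_n.+1,
  forall (nu : iseq n beta) t, nu t = i_ (col nu t).
Proof.
exists (fun nu => xchoose (iseq_colouring nu)) => nu t.
by have /forallP/(_ t)/eqP := xchooseP (iseq_colouring nu).
Qed.

End ColourCount.

Section Colouring.
Variables (C : cartan_datum) (n : nat) (i_ : 'I_n.+1 -> C) (hi : injective i_).
Variables (beta : weight_lattice C) (col : iseq n beta -> 'S_n.+1).
Hypothesis colE : forall (nu : iseq n beta) t, nu t = i_ (col nu t).
Implicit Types (nu mu : iseq n beta) (w v : 'S_n.+1) (l : 'I_n).

Lemma iseq_fun_inj nu : injective nu.
Proof. by move=> s t; rewrite !colE => /hi/perm_inj. Qed.

Lemma iseq_fun_neq nu s t : s != t -> nu s != nu t.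
Proof. by apply: contraNneq => /iseq_fun_inj ->. Qed.

Lemma colour_act w nu : col (iseq_act w nu) = (w^-1 * col nu)%g.
Proof. by apply/permP => t; apply: hi; rewrite -colE iseq_actE permM -colE. Qed.

Lemma iseq_act_free w v nu : iseq_act w nu = iseq_act v nu -> w = v.
Proof. by move=> /(congr1 col); rewrite !colour_act => /mulIg /invg_inj. Qed.

Definition position nu : 'S_n.+1 := (col nu)^-1.

Lemma position_act w nu : position (iseq_act w nu) = (position nu * w)%g.
Proof. by rewrite /position colour_act invMg invgK. Qed.

End Colouring.

(** * KLR algebras without repeated colours *)

Section DistinctKLRAlgebra.
Variables (k : idomainType) (gr : grading k) (C : cartan_datum).
Variables (Q : klr_datum gr C) (n : nat) (beta : weight_lattice C).
Implicit Types (nu mu : iseq n beta) (w v : 'S_n.+1) (l : 'I_n).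
Implicit Types (f g : {mpoly k[n.+1]}).
Local Notation "@@ l" := (inord l : 'I_n.+1) (at level 8, format "@@ l").

Definition crossing_pol l nu : {mpoly k[n.+1]} :=
  subst2 (Q (nu @@l) (nu @@l.+1)) @@l @@l.+1.

(** What the relations become when no colour is repeated: all correction terms
vanish. The last field says that R is generated by the other data. *)
Record distinct_klr (R : pzAlgType k) := DistinctKLR {
  dklr_e : iseq n beta -> R;
  dklr_x : 'I_n.+1 -> R;
  dklr_tau : 'I_n -> R;
  dklr_eM : forall nu mu, dklr_e nu * dklr_e mu = if nu == mu then dklr_e nu else 0;
  dklr_sum_e : \sum_nu dklr_e nu = 1;
  dklr_xC : forall i j, dklr_x i * dklr_x j = dklr_x j * dklr_x i;
  dklr_xe : forall i nu, dklr_x i * dklr_e nu = dklr_e nu * dklr_x i;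
  dklr_tau_e : forall l nu, dklr_tau l * dklr_e nu
    = dklr_e (iseq_act (adjtr n l) nu) * dklr_tau l;
  dklr_tau_far : forall l l', (l.+1 < l')%N || (l'.+1 < l)%N ->
    dklr_tau l * dklr_tau l' = dklr_tau l' * dklr_tau l;
  dklr_tau_sqr : forall l nu, dklr_tau l * dklr_tau l * dklr_e nu
    = xpol dklr_x (crossing_pol l nu) * dklr_e nu;
  dklr_tau_x : forall l j, dklr_tau l * dklr_x j
    = dklr_x (adjtr n l j) * dklr_tau l;
  dklr_tau_braid : forall l l', l' = l.+1 :> nat ->
    dklr_tau l' * dklr_tau l * dklr_tau l' = dklr_tau l * dklr_tau l' * dklr_tau l;
  dklr_ind : forall P : R -> Prop,
    P 0 -> P 1 -> (forall u1 u2, P u1 -> P u2 -> P (u1 + u2)) ->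
    (forall c u, P u -> P (algc c * u)) -> (forall nu u, P u ->
      P (dklr_e nu * u)) ->
    (forall j u, P u -> P (dklr_x j * u)) -> (forall l u, P u ->
      P (dklr_tau l * u)) ->
    forall u, P u
}.

Variables (R : pzAlgType k) (S : distinct_klr R).
Variables (red : 'S_n.+1 -> seq 'I_n) (hred : forall w, reduced_expr w (red w)).
Local Notation e := (dklr_e S).
Local Notation x := (dklr_x S).
Local Notation tau := (dklr_tau S).

Lemma klr_xpol_e f nu : xpol x f * e nu = e nu * xpol x f.
Proof.
by apply/esym/xpol_intertwine => i; rewrite (dklr_xe S).
Qed.

Lemma klr_xpolM f g : xpol x (f * g) = xpol x f * xpol x g.
Proof. exact/xpolM/dklr_xC. Qed.

Lemma klr_tau_xpol l f : tau l * xpol x f = xpol x (msym (adjtr n l) f) * tau l.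
Proof.
rewrite (xpol_msym (dklr_xC S)); apply: xpol_intertwine => i; exact: (dklr_tau_x S).
Qed.

Definition tau_word s : R := \prod_(l <- s) tau l.

Definition tau_perm w : R := tau_word (red w).

(** The braid relations hold without correction, so all reduced words of a
permutation give the same element. *)
Lemma tau_perm_word s : reduced s ->
  tau_word s = tau_perm (word_perm s).
Proof.
have [red_w w_red] := reduced_exprP (hred (word_perm s)) => red_s.
exact: (matsumoto (dklr_tau_far S) (dklr_tau_braid S) red_s red_w (esym w_red)).
Qed.

Lemma tau_perm1 : tau_perm 1 = 1.
Proof.
have red0 : reduced ([::] : seq 'I_n) by rewrite /reduced word_perm0 perm_length1.
by have := tau_perm_word red0; rewrite word_perm0 => <-; rewrite /tau_word big_nil.
Qed.

Lemma tau_perm_ascent w l : ascent w l -> tau l * tau_perm w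
  = tau_perm (w * adjtr n l).
Proof.
have [red_w w_red] := reduced_exprP (hred w) => asc.
have red_lw : reduced (l :: red w) by rewrite reduced_cons red_w w_red.
by rewrite -[in RHS]w_red -word_perm_cons -tau_perm_word // [RHS]big_cons.
Qed.

Lemma tau_perm_descent w l : ~~ ascent w l -> tau_perm w
  = tau l * tau_perm (w * adjtr n l).
Proof.
by move=> des; rewrite tau_perm_ascent ?ascent_adjtr // -mulgA adjtrK mulg1.
Qed.

Lemma tau_perm_ascent_r w l : (w @@l < w @@l.+1)%N ->
  tau_perm w * tau l = tau_perm (adjtr n l * w).
Proof.
have [red_w w_red] := reduced_exprP (hred w) => asc.
have red_wl : reduced (rcons (red w) l).
  rewrite /reduced size_rcons word_perm_rcons w_red -perm_lengthV invMg adjtrV.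
  rewrite perm_length_ascent ?perm_lengthV; last by rewrite /ascent invgK.
  by move: red_w; rewrite /reduced w_red.
rewrite -[in RHS]w_red -word_perm_rcons -tau_perm_word //.
by rewrite /tau_perm /tau_word -cats1 big_cat big_seq1.
Qed.

Lemma tau_word_e s nu :
  tau_word s * e nu = e (iseq_act (word_perm s) nu) * tau_word s.
Proof.
rewrite /tau_word; elim: s => [|l s IH].
  by rewrite !big_nil word_perm0 iseq_act1 mul1r mulr1.
by rewrite !big_cons -mulrA IH mulrA (dklr_tau_e S) word_perm_cons iseq_actM mulrA.
Qed.

Lemma tau_perm_e w nu : tau_perm w * e nu = e (iseq_act w nu) * tau_perm w.
Proof. by rewrite tau_word_e; have [_ ->] := reduced_exprP (hred w). Qed.

Lemma tau_perm_xpol w f : tau_perm w * xpol x f = xpol x (msym w f) * tau_perm w.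
Proof.
have [_ {2}<-] := reduced_exprP (hred w); rewrite /tau_perm /tau_word.
elim: (red w) f => [|l s IH] f.
  by rewrite !big_nil word_perm0 msym1m mul1r mulr1.
by rewrite !big_cons -mulrA IH mulrA klr_tau_xpol word_perm_cons msymMm mulrA.
Qed.

Lemma xpol_tau_perm w f :
  xpol x f * tau_perm w = tau_perm w * xpol x (msym w^-1 f).
Proof. by rewrite tau_perm_xpol -msymMm mulVg msym1m. Qed.

(** A descent creates a square of a generator, hence a factor Q. *)
Lemma tau_tau_perm w l nu : ~~ ascent w l ->
  tau l * tau_perm w * e nu = tau_perm (w * adjtr n l)
    * xpol x (msym (w * adjtr n l)^-1 (crossing_pol l (iseq_act (w * adjtr n l)
      nu))) * e nu.
Proof.
move=> des; set v := (w * adjtr n l)%g.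
rewrite (tau_perm_descent des) -/v mulrA -mulrA tau_perm_e mulrA (dklr_tau_sqr S).
by rewrite -[LHS]mulrA -tau_perm_e mulrA xpol_tau_perm.
Qed.

Definition klr_term nu w f : R := tau_perm w * xpol x f * e nu.

Definition klr_comb (F : iseq n beta -> 'S_n.+1 -> {mpoly k[n.+1]}) : R :=
  \sum_nu \sum_w klr_term nu w (F nu w).

Lemma klr_termD nu w f g : klr_term nu w (f + g)
  = klr_term nu w f + klr_term nu w g.
Proof. by rewrite /klr_term raddfD mulrDr mulrDl. Qed.

Lemma klr_term0 nu w : klr_term nu w 0 = 0.
Proof. by rewrite /klr_term raddf0 mulr0 mul0r. Qed.

Lemma klr_termZ nu w c f : klr_term nu w (c *: f) = algc c * klr_term nu w f.
Proof.
by rewrite /klr_term xpolZ !mulrA algcC.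
Qed.

Lemma klr_combD F1 F2 :
  klr_comb (fun nu w => F1 nu w + F2 nu w) = klr_comb F1 + klr_comb F2.
Proof.
rewrite /klr_comb -big_split; apply: eq_bigr => nu _.
by rewrite -big_split; apply: eq_bigr => w _; rewrite klr_termD.
Qed.

Lemma klr_combB F1 F2 :
  klr_comb (fun nu w => F1 nu w - F2 nu w) = klr_comb F1 - klr_comb F2.
Proof.
by apply: (addIr (klr_comb F2)); rewrite -klr_combD subrK; apply: eq_bigr => nu _;
   apply: eq_bigr => w _; rewrite subrK.
Qed.

Lemma klr_comb0 : klr_comb (fun _ _ => 0) = 0.
Proof. by rewrite /klr_comb big1 // => nu _; rewrite big1 // => w _; apply:
  klr_term0. Qed.

Lemma klr_comb_term nu w f :
  klr_comb (fun mu v => if (mu == nu) && (v == w) then f else 0) = klr_term nu w f.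
Proof.
rewrite /klr_comb (bigD1 nu) //= [X in _ + X]big1 ?addr0 => [|mu /negPf ->];
  last first.
  by rewrite big1 // => v _; apply: klr_term0.
rewrite (bigD1 w) //= !eqxx [X in _ + X]big1 ?addr0 // => v /negPf ->.
by rewrite klr_term0.
Qed.

Definition klr_spanned (u : R) : Prop := exists F, u = klr_comb F.

Lemma klr_spannedD (u v : R) : klr_spanned u -> klr_spanned v ->
  klr_spanned (u + v).
Proof. by move=> [F ->] [G ->]; exists (fun nu w => F nu w + G nu w);
  rewrite klr_combD. Qed.

Lemma klr_spanned0 : klr_spanned 0.
Proof. by exists (fun _ _ => 0); rewrite klr_comb0. Qed.

Lemma klr_spanned_sum (I : Type) (s : seq I) (P : pred I) (u : I -> R) :
  (forall i, P i -> klr_spanned (u i)) -> klr_spanned (\sum_(i <- s | P i) u i).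
Proof. by apply: big_ind; [apply: klr_spanned0 | apply: klr_spannedD]. Qed.

Lemma klr_spanned_term nu w f : klr_spanned (klr_term nu w f).
Proof. by eexists; rewrite -klr_comb_term. Qed.

Lemma klr_spannedMl (a : R) :
  (forall nu w f, klr_spanned (a * klr_term nu w f)) ->
  forall u, klr_spanned u -> klr_spanned (a * u).
Proof.
move=> aT u [F ->]; rewrite mulr_sumr; apply: klr_spanned_sum => nu _.
by rewrite mulr_sumr; apply: klr_spanned_sum => w _.
Qed.

Lemma klr_term_e nu w f : klr_term nu w f
  = e (iseq_act w nu) * tau_perm w * xpol x f.
Proof. by rewrite /klr_term -mulrA klr_xpol_e mulrA tau_perm_e. Qed.

(** The span of the terms contains 1 and is stable under left multiplication by
the generators. *)
Lemma klr_span (u : R) : klr_spanned u.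
Proof.
move: u; apply: (@dklr_ind _ S klr_spanned) => [||u v|c u|mu u|j u|l u].
- exact: klr_spanned0.
- rewrite -(dklr_sum_e S); apply: klr_spanned_sum => nu _.
  have -> : e nu = klr_term nu 1 1 by rewrite /klr_term tau_perm1 xpol1 !mul1r.
  exact: klr_spanned_term.
- exact: klr_spannedD.
- apply: klr_spannedMl => nu w f; rewrite -klr_termZ; exact: klr_spanned_term.
- apply: klr_spannedMl => nu w f; rewrite klr_term_e !mulrA (dklr_eM S).
  case: eqP => [->|_]; first by rewrite -klr_term_e; apply: klr_spanned_term.
  by rewrite !mul0r; apply: klr_spanned0.
- apply: klr_spannedMl => nu w f; rewrite -(xpolXi x) /klr_term !mulrA.
  rewrite xpol_tau_perm -[_ * _ * xpol _ f]mulrA -klr_xpolM.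
  exact: klr_spanned_term.
apply: klr_spannedMl => nu w f; rewrite /klr_term !mulrA.
have [asc|des] := boolP (ascent w l).
  by rewrite tau_perm_ascent //; apply: klr_spanned_term.
rewrite -mulrA klr_xpol_e mulrA tau_tau_perm // -mulrA -klr_xpol_e mulrA.
by rewrite -[_ * _ * xpol _ _]mulrA -klr_xpolM; apply: klr_spanned_term.
Qed.

End DistinctKLRAlgebra.

Section KLRDistinctColours.
Variables (k : idomainType) (gr : grading k) (C : cartan_datum).
Variables (Q : klr_datum gr C) (n : nat).
Variables (i_ : 'I_n.+1 -> C) (hi : injective i_).
Variables (beta : weight_lattice C) (col : iseq n beta -> 'S_n.+1).
Hypothesis colE : forall (nu : iseq n beta) t, nu t = i_ (col nu t).
Implicit Types (nu mu : iseq n beta) (w v : 'S_n.+1) (l : 'I_n).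
Implicit Types (f g : {mpoly k[n.+1]}).
Local Notation R := (klr Q n beta).
Local Notation e := (@klr_e k gr C Q n beta).
Local Notation x := (@klr_x k gr C Q n beta).
Local Notation tau := (@klr_tau k gr C Q n beta).
Local Notation "@@ l" := (inord l : 'I_n.+1) (at level 8, format "@@ l").
Local Notation to_klr := (to_quot (@klr_relator k gr C Q n beta)).

Lemma klr_relE (u v : klr_free k n beta) :
  klr_rel Q (n := n) (beta := beta) u v -> to_klr u = to_klr v.
Proof.
move=> uv; apply/to_quotP; rewrite -[_ - _]mul1r -[1 * _]mulr1 -[X in ideal_gen
  _ X]addr0.
by apply: ideal_genD; [exists u, v | apply: ideal_gen0].
Qed.

(** Each shape of relation is carried over to R for arbitrary elements of the free
algebra; the generators are substituted afterwards. *)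
Lemma klr_relM (u v r : klr_free k n beta) :
  klr_rel Q (u * v) r -> to_klr u * to_klr v = to_klr r :> R.
Proof. by move/klr_relE <-; rewrite to_quotM. Qed.

Lemma klr_relMM (u v u' v' : klr_free k n beta) :
  klr_rel Q (u * v) (u' * v') -> to_klr u * to_klr v = to_klr u' * to_klr v' :> R.
Proof. by move/klr_relM ->; rewrite to_quotM. Qed.

Lemma klr_relMMM (u v r u' v' : klr_free k n beta) :
  klr_rel Q (u * v * r) (u' * v') ->
  to_klr u * to_klr v * to_klr r = to_klr u' * to_klr v' :> R.
Proof. by move/klr_relMM; rewrite to_quotM. Qed.

Lemma klr_relB2 (u v u' v' r : klr_free k n beta) :
  klr_rel Q ((u * v - u' * v') * r) 0 ->
  (to_klr u * to_klr v - to_klr u' * to_klr v') * to_klr r = 0 :> R.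
Proof. by move/klr_relE; rewrite (rmorph_comm2 to_klr) rmorph0. Qed.

Lemma klr_relB3 (u v t u' v' t' r : klr_free k n beta) :
  klr_rel Q ((u * v * t - u' * v' * t') * r) 0 ->
  (to_klr u * to_klr v * to_klr t - to_klr u' * to_klr v' * to_klr t') * to_klr r
    = 0 :> R.
Proof. by move/klr_relE; rewrite (rmorph_comm3 to_klr) rmorph0. Qed.

Lemma klr_eM nu mu : e nu * e mu = if nu == mu then e nu else 0.
Proof.
by apply: etrans (klr_relM (klr_ee Q nu mu)) _; case: eqP; rewrite ?rmorph0.
Qed.

Lemma klr_sum_eE : \sum_nu e nu = 1.
Proof. by have := klr_relE (klr_sum_e Q n beta); rewrite rmorph_sum rmorph1. Qed.

Lemma klr_xC i j : x i * x j = x j * x i.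
Proof. exact: klr_relMM (klr_xx Q beta i j). Qed.

Lemma klr_xeC i nu : x i * e nu = e nu * x i.
Proof. exact: klr_relMM (klr_xe Q i nu). Qed.

Lemma klr_tau_eE l nu : tau l * e nu = e (iseq_act (adjtr n l) nu) * tau l.
Proof. exact: klr_relMM (klr_tau_e Q l nu). Qed.

Lemma klr_tau_far l l' : (l.+1 < l')%N || (l'.+1 < l)%N ->
  tau l * tau l' = tau l' * tau l.
Proof. by move=> far; exact: klr_relMM (klr_tau_tau Q beta far). Qed.

Lemma klr_split_e (u v : R) : (forall nu, u * e nu = v * e nu) -> u = v.
Proof.
move=> uv; rewrite -[u]mulr1 -[v]mulr1 -klr_sum_eE !mulr_sumr.
by apply: eq_bigr => nu _.
Qed.

Lemma klr_tau_sqr l nu : tau l * tau l * e nu = xpol x (crossing_pol Q l nu) * e nu.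
Proof.
apply: etrans (klr_relMMM (klr_tau2 Q l nu)) _; congr (_ * _).
exact: xpol_morph.
Qed.

Lemma klr_tau_xC l j : tau l * x j = x (adjtr n l j) * tau l.
Proof.
apply/eqP; rewrite -subr_eq0; apply/eqP/klr_split_e => nu.
have := klr_tau_x Q l j nu.
rewrite (negPf (iseq_fun_neq hi colE nu (lo_neq_hi l))) !andbF mul0r.
exact: klr_relB2.
Qed.

Lemma klr_tau_braid l l' : l' = l.+1 :> nat ->
  tau l' * tau l * tau l' = tau l * tau l' * tau l.
Proof.
move=> ll'; apply/eqP; rewrite -subr_eq0; apply/eqP/klr_split_e => nu.
have lo_neq : @@l != @@l.+2.
  have := ltn_ord l'; rewrite ll' => lt_n.
  by rewrite -val_eqE /= val_lo inordK //; lia.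
rewrite mul0r; exact: klr_relB3 (klr_braid0 Q ll' (iseq_fun_neq hi colE nu lo_neq)).
Qed.


Lemma klr_gen_ind (P : R -> Prop) :
    P 0 -> P 1 -> (forall u1 u2, P u1 -> P u2 -> P (u1 + u2)) ->
    (forall c u, P u -> P (algc c * u)) -> (forall nu u, P u -> P (e nu * u)) ->
    (forall j u, P u -> P (x j * u)) -> (forall l u, P u -> P (tau l * u)) ->
    forall u, P u.
Proof.
move=> P0 P1 PD PZ Pe Px Pt u; have [{}u ->] := to_quot_surj u.
elim/free_alg_ind: u => [||u1 u2|c u|g u].
- by rewrite rmorph0.
- by rewrite rmorph1.
- by rewrite to_quotD; apply: PD.
- by rewrite to_quotM => /(PZ c).
by rewrite to_quotM; case: g => [[nu|j]|l]; [apply: Pe | apply: Px | apply: Pt].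
Qed.

Definition klr_distinct : @distinct_klr k gr C Q n beta R :=
  DistinctKLR klr_eM klr_sum_eE klr_xC klr_xeC klr_tau_eE klr_tau_far
    klr_tau_sqr klr_tau_xC klr_tau_braid klr_gen_ind.

End KLRDistinctColours.

(** * Double crossings *)

Section CrossingCocycle.
Variables (S : comPzRingType) (n : nat) (q : 'I_n.+1 -> 'I_n.+1 -> S).
Hypothesis q_sym : forall c d, q c d = q d c.
Implicit Types (o a b d r : 'S_n.+1) (l : 'I_n).
Local Notation "@@ l" := (inord l : 'I_n.+1) (at level 8, format "@@ l").

(** An arrangement is given by the map o from colours to positions. *)
Definition precedes o (i j : 'I_n.+1) : bool := (o i < o j)%N.

Lemma precedes_total o i j : i != j -> precedes o j i = ~~ precedes o i j.
Proof.
move=> ij; rewrite /precedes -leqNgt [RHS]leq_eqVlt.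
by rewrite val_eqE (inj_eq perm_inj) eq_sym (negPf ij).
Qed.

(** The product of q over the pairs that cross twice on the way from a to d
through b; each such pair is listed in the order that it has in a and d. *)
Definition crossing a b d : S := \prod_(p : 'I_n.+1 * 'I_n.+1 |
  [&& precedes a p.1 p.2, precedes d p.1 p.2 & precedes b p.2 p.1]) q p.1 p.2.

Definition crossed a b d (i j : 'I_n.+1) : bool :=
  (precedes a i j == precedes d i j) && (precedes a i j != precedes b i j).

(** As q is symmetric, each pair can be listed in its numerical order instead,
whatever the arrangements. *)
Lemma crossing_unordered a b d :
  crossing a b d = \prod_(p : 'I_n.+1 * 'I_n.+1 | (p.1 < p.2)%N)
    q p.1 p.2 ^+ crossed a b d p.1 p.2.
Proof.
rewrite /crossing (bigID (fun p : 'I_n.+1 * 'I_n.+1 => (p.1 < p.2)%N)) /=.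
rewrite [X in _ * X](reindex (fun p : 'I_n.+1 * 'I_n.+1 => (p.2, p.1))) /=;
  last first.
  by exists (fun p => (p.2, p.1)) => -[].
rewrite [X in _ * X](eq_bigl (fun p : 'I_n.+1 * 'I_n.+1 =>
  [&& precedes a p.2 p.1, precedes d p.2 p.1 & precedes b p.1 p.2]
  && (p.1 < p.2)%N)) => [|[i j] /=]; last first.
  rewrite -leqNgt leq_eqVlt; case: eqP => [/val_inj ->|//].
  by rewrite /precedes !ltnn.
rewrite !big_mkcondl /=.
rewrite -big_split /=; apply: eq_bigr => -[i j] /= ij.
have nij : i != j by rewrite -val_eqE /= ltn_eqF.
rewrite !(precedes_total _ nij) /crossed q_sym.
by case: (precedes a i j); case: (precedes b i j); case: (precedes d i j);
   rewrite /= ?expr0 ?expr1 ?mulr1 ?mul1r.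
Qed.

(** Both sides count each pair equally often; it suffices to compare the four
relative orders of one pair. *)
Lemma crossing_cocycle r a b d :
  crossing r b a * crossing r d b = crossing a b d * crossing r d a.
Proof.
rewrite !crossing_unordered -!big_split; apply: eq_bigr => -[i j] /= _.
rewrite -!exprD; congr (_ ^+ _); rewrite /crossed.
by case: (precedes r i j); case: (precedes a i j); case: (precedes b i j);
   case: (precedes d i j).
Qed.

Lemma precedes_adjtr o l i j :
  precedes o j i && precedes (o * adjtr n l) i j = (o j == @@l) && (o i == @@l.+1).
Proof.
rewrite /precedes !permM -!val_eqE /= val_lo val_hi !adjtrE.
by split_tests; lia.
Qed.

Lemma crossing_adjacent r o l : crossing r o (o * adjtr n l)
  = let i := (o^-1)%g @@l in let j := (o^-1)%g @@l.+1 in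
    if precedes r j i then q j i else 1.
Proof.
have E p : [&& precedes r p.1 p.2,
  precedes (o * adjtr n l) p.1 p.2 & precedes o p.2 p.1]
    = precedes r p.1 p.2 && (p == ((o^-1)%g @@l.+1, (o^-1)%g @@l)).
  case: p => i j /=; rewrite xpair_eqE; congr (_ && _).
  rewrite andbC precedes_adjtr andbC.
  have invE s t : (o s == t) = (s == (o^-1)%g t).
    by rewrite -(inj_eq (@perm_inj _ o) s) permKV.
  by rewrite !invE.
rewrite /crossing (eq_bigl _ _ E) /=; case: ifP => rji.
  rewrite (bigD1 ((o^-1)%g @@l.+1, (o^-1)%g @@l)) /=; last by rewrite rji eqxx.
  by rewrite big1 ?mulr1 // => p /andP[/andP[_ ->]].
by rewrite big1 // => p /andP[rp /eqP pE]; move: rp; rewrite pE /= rji.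
Qed.

(** Two strands that have not crossed yet produce no double crossing. *)
Lemma crossing_ascent o (w : 'S_n.+1) l : ascent w l ->
  crossing (o * w * adjtr n l) (o * w) o = 1.
Proof.
move=> asc; rewrite /crossing big1 // => -[i j] /= /and3P[p1 p2 p3].
have := precedes_adjtr (o * w) l i j; rewrite p1 p3 /= =>
  /esym/andP[/eqP jl /eqP il].
have wj : (w^-1)%g @@l = o j by rewrite -jl permM permK.
have wi : (w^-1)%g @@l.+1 = o i by rewrite -il permM permK.
by move: asc p2; rewrite /ascent wi wj /precedes => /ltnW; rewrite leqNgt =>
  /negPf ->.
Qed.

End CrossingCocycle.

Section CrossingDivisibility.
Variables (A : comPzRingType) (n : nat) (q : 'I_n.+1 -> 'I_n.+1 -> A).
Implicit Types (o a b d : 'S_n.+1) (c : 'I_n.+1).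

Lemma crossing_swap a b d : crossing q a b d = crossing q d b a.
Proof. by apply: eq_bigl => p; rewrite andbCA. Qed.

Definition common_left a d c : A := \prod_(i | precedes a i c && precedes d i
  c) q i c.

Lemma common_leftC a d c : common_left a d c = common_left d a c.
Proof. by apply: eq_bigl => i; rewrite andbC. Qed.

(** A colour to the left of c in both a and d either is so in b, or crosses c
twice on the way from a to d through b. *)
Lemma crossing_common_left a b d c :
  exists r, crossing q a b d * common_left b d c = r * common_left a d c.
Proof.
pose cr i j := [&& precedes a i j, precedes d i j & precedes b j i].
have -> : crossing q a b d = \prod_j \prod_(i | cr i j) q i j.
  rewrite /crossing (eq_bigl (fun p : 'I_n.+1 * 'I_n.+1 =>
    xpredT p.2 && cr p.1 p.2)) //.
  rewrite (reindex (fun p : 'I_n.+1 * 'I_n.+1 => (p.2, p.1))) /=; last first.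
    by exists (fun p => (p.2, p.1)) => -[].
  by rewrite pair_big_dep.
have splitL : common_left b d c =
    \prod_(i | precedes a i c && precedes d i c && precedes b i c) q i c
    * \prod_(i | precedes b i c && precedes d i c && ~~ precedes a i c) q i c.
  rewrite /common_left (bigID (precedes a ^~ c)) /=; congr (_ * _).
  by apply: eq_bigl => i; do 3!case: (precedes _ _ _).
have splitR : common_left a d c =
    \prod_(i | precedes a i c && precedes d i c && precedes b i c) q i c
    * \prod_(i | cr i c) q i c.
  rewrite /common_left (bigID (precedes b ^~ c)) /=; congr (_ * _).
  apply: eq_bigl => i; rewrite /cr -andbA.
  have [->|ic] := eqVneq i c; first by rewrite /precedes ltnn.
  by rewrite (precedes_total b ic).
rewrite (bigD1 c) //= splitL splitR.
exists ((\prod_(j | j != c) \prod_(i | cr i j) q i j)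
  * \prod_(i | precedes b i c && precedes d i c && ~~ precedes a i c) q i c).
rewrite [X in X * _]mulrC [X in _ * X]mulrC mulrACA; congr (_ * _).
exact: mulrC.
Qed.

End CrossingDivisibility.

(** * The matrix model *)

Section MonomialMatrices.
Variables (k : comNzRingType) (n : nat) (T : finType).
Implicit Types (g h : T -> T) (c d : T -> {mpoly k[n]}).

Definition pol_matrix : Type := 'M[{mpoly k[n]}]_#|T|.
HB.instance Definition _ := GRing.PzRing.on pol_matrix.

Definition pol_scalar (c : k) : pol_matrix := (c%:MP_[n])%:M.

Lemma pol_scalar_zmod : zmod_morphism pol_scalar.
Proof. by move=> c d; rewrite /pol_scalar !raddfB. Qed.

Lemma pol_scalar_monoid : monoid_morphism pol_scalar.
Proof.
split=> [|c d]; first by rewrite /pol_scalar mpolyC1.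
by rewrite /pol_scalar mpolyCM scalar_mxM.
Qed.

Lemma pol_scalar_central (a : k) (A : pol_matrix) : pol_scalar a * A
  = A * pol_scalar a.
Proof. exact/esym/scalar_mxC. Qed.

HB.instance Definition _ :=
  isPzAlgebra.Build k pol_matrix pol_scalar_zmod pol_scalar_monoid
    pol_scalar_central.

(** Column nu has its only nonzero entry in row g nu; all generators act by
matrices of this kind. *)
Definition mono g c : pol_matrix :=
  \matrix_(i, j) if enum_val i == g (enum_val j) then c (enum_val j) else 0.

Lemma monoE g c mu nu : mono g c (enum_rank mu) (enum_rank nu)
  = if mu == g nu then c nu else 0.
Proof. by rewrite mxE !enum_rankK. Qed.

Lemma pol_matrixP (A B : pol_matrix) :
  (forall mu nu, A (enum_rank mu) (enum_rank nu)
    = B (enum_rank mu) (enum_rank nu)) ->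
  A = B.
Proof.
by move=> AB; apply/matrixP => i j; rewrite -(enum_valK i) -(enum_valK j) AB.
Qed.

Lemma eq_mono g h c d : g =1 h -> c =1 d -> mono g c = mono h d.
Proof. by move=> gh cd; apply/matrixP => i j; rewrite !mxE gh cd. Qed.

Lemma mulE (A B : pol_matrix) mu nu : (A * B) (enum_rank mu) (enum_rank nu)
  = \sum_t A (enum_rank mu) (enum_rank t) * B (enum_rank t) (enum_rank nu).
Proof.
rewrite [LHS]mxE (reindex enum_rank) //.
by exists enum_val => i _; [apply: enum_rankK | apply: enum_valK].
Qed.

Lemma monoM g h c d :
  mono g c * mono h d = mono (g \o h) (fun nu => c (h nu) * d nu).
Proof.
apply: pol_matrixP => mu nu; rewrite mulE monoE (bigD1 (h nu)) //=.
rewrite !monoE eqxx big1 ?addr0 => [|t /negPf th].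
  by case: eqP; rewrite ?mul0r.
by rewrite !monoE th mulr0.
Qed.

Lemma monoMM g1 g2 g3 c1 c2 c3 : mono g1 c1 * mono g2 c2 * mono g3 c3
  = mono (g1 \o g2 \o g3) (fun nu => c1 (g2 (g3 nu)) * c2 (g3 nu) * c3 nu).
Proof. by rewrite !monoM. Qed.

Lemma monoD g c d : mono g c + mono g d = mono g (fun nu => c nu + d nu).
Proof. by apply/matrixP => i j; rewrite !mxE; case: eqP; rewrite ?addr0. Qed.

Lemma mono0 g : mono g (fun=> 0) = 0.
Proof. by apply/matrixP => i j; rewrite !mxE; case: eqP. Qed.

Lemma mono_sum (I : Type) (s : seq I) g (c : I -> T -> {mpoly k[n]}) :
  \sum_(i <- s) mono g (c i) = mono g (fun nu => \sum_(i <- s) c i nu).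
Proof.
elim: s => [|i s IH]; rewrite ?big_cons ?big_nil.
  by rewrite -(mono0 g); apply: eq_mono => // nu; rewrite big_nil.
by rewrite IH monoD; apply: eq_mono => // nu; rewrite big_cons.
Qed.

Lemma mono_algc a : algc a = mono id (fun=> a%:MP_[n]).
Proof.
by apply/matrixP => i j; rewrite !mxE (inj_eq enum_val_inj); case: eqP.
Qed.

Lemma mono1 : 1 = mono id (fun=> 1).
Proof. by have := mono_algc 1; rewrite rmorph1 mpolyC1. Qed.

Lemma mono_exp c j : mono id c ^+ j = mono id (fun nu => c nu ^+ j).
Proof.
elim: j => [|j IH]; first by rewrite expr0 mono1; apply: eq_mono => nu;
  rewrite ?expr0.
by rewrite exprS IH monoM; apply: eq_mono => // nu; rewrite exprS.
Qed.

Lemma xpol_mono (y : 'I_n -> T -> {mpoly k[n]}) p :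
  xpol (fun j => mono id (y j)) p = mono id (fun nu =>
    mmap (@mpolyC n k) (y^~ nu) p).
Proof.
rewrite /xpol /mmap -mono_sum; apply: eq_bigr => m _.
have -> : xmon (fun j => mono id (y j)) m = mono id (fun nu => mmap1 (y^~ nu) m).
  rewrite /xmon /mmap1; elim: (index_enum _) => [|j s IH].
    by rewrite big_nil mono1; apply: eq_mono => // nu; rewrite big_nil.
  rewrite big_cons IH mono_exp monoM; apply: eq_mono => // nu.
  by rewrite big_cons.
by rewrite mono_algc monoM.
Qed.

End MonomialMatrices.

Section Substitution.
Variables (k : comNzRingType) (n : nat).
Implicit Types (p : {mpoly k[2]}) (a b : 'I_n).

Lemma subst2E p a b : subst2 p a b
  = \sum_(m <- msupp p) p@_m *: ('X_a ^+ m ord0 * 'X_b ^+ m ord_max).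
Proof.
rewrite /subst2 comp_mpolyE; apply: eq_bigr => m _.
rewrite !big_ord_recl big_ord0 mulr1 /=.
by have -> : lift ord0 ord0 = ord_max :> 'I_2 by apply/val_inj.
Qed.

Lemma msym_subst2 (s : 'S_n) p a b : msym s (subst2 p a b) = subst2 p (s a) (s b).
Proof.
have sX c : msym s 'X_c = 'X_(s c) :> {mpoly k[n]} by rewrite /msym mmapX mmap1U.
rewrite !subst2E raddf_sum; apply: eq_bigr => m _.
by rewrite /= msymZ msymM !rmorphXn /= !sX.
Qed.

End Substitution.

Lemma subst2_swap (k : comNzRingType) (n : nat) (p : {mpoly k[2]}) (a b : 'I_n) :
  subst2 (subst2 p ord_max ord0) a b = subst2 p b a.
Proof.
rewrite [in RHS]subst2E [X in subst2 X](subst2E p) /subst2 raddf_sum.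
apply: eq_bigr => m _; rewrite /= comp_mpolyZ rmorphM !rmorphXn /=.
by rewrite !comp_mpolyXU.
Qed.

Lemma eq_sub_mul0 (A : pzRingType) (u v r : A) : u = v -> (u - v) * r = 0.
Proof. by move=> ->; rewrite subrr mul0r. Qed.

Section KLRModel.
Variables (k : idomainType) (gr : grading k) (C : cartan_datum).
Variables (Q : klr_datum gr C) (n : nat).
Variables (i_ : 'I_n.+1 -> C) (hi : injective i_).
Variables (beta : weight_lattice C) (col : iseq n beta -> 'S_n.+1).
Hypothesis colE : forall (nu : iseq n beta) t, nu t = i_ (col nu t).
Implicit Types (nu mu : iseq n beta) (w v : 'S_n.+1) (l : 'I_n).
Local Notation "@@ l" := (inord l : 'I_n.+1) (at level 8, format "@@ l").
Local Notation pos := (position col).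
Local Notation M := (pol_matrix k n.+1 (iseq n beta)).
Local Notation act := (@iseq_act C n beta).

(** Q in the variables of two colours: in the model, variables are attached to
colours and not to positions. *)
Definition colour_pol (c d : 'I_n.+1) : {mpoly k[n.+1]} :=
  subst2 (Q (i_ c) (i_ d)) c d.

Lemma colour_pol_sym c d : colour_pol c d = colour_pol d c.
Proof. by rewrite /colour_pol klr_Q_sym subst2_swap. Qed.

(** The entry at (mu, nu) of the image of the basis element leading from nu to
mu: the pairs that are in reference order in mu but not in nu contribute Q. *)
Definition model_coef mu nu : {mpoly k[n.+1]} :=
  crossing colour_pol 1 (pos nu) (pos mu).

(** One of the two crossings of c and d acts by 1, the other one by Q, so that
their product is Q. *)
Definition half_pol (c d : 'I_n.+1) : {mpoly k[n.+1]} :=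
  if (d < c)%N then colour_pol c d else 1.

Lemma model_coef_adj l nu :
  model_coef (act (adjtr n l) nu) nu = half_pol (col nu @@l) (col nu @@l.+1).
Proof.
rewrite /model_coef (position_act hi colE) crossing_adjacent /= /position invgK.
by rewrite /precedes !perm1 /half_pol colour_pol_sym.
Qed.

Lemma half_polM c d : c != d -> half_pol c d * half_pol d c = colour_pol c d.
Proof.
rewrite -val_eqE /half_pol /=; case: (ltngtP c d) => [_|_|//] _.
  by rewrite mul1r colour_pol_sym.
by rewrite mulr1.
Qed.

Lemma colour_act_adj l nu t : col (act (adjtr n l) nu) t = col nu (adjtr n l t).
Proof. by rewrite (colour_act hi colE) permM adjtrV. Qed.

Lemma colour_crossing l nu : msym (col nu) (subst2 (Q (nu @@l) (nu @@l.+1)) @@l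
  @@l.+1)
  = colour_pol (col nu @@l) (col nu @@l.+1).
Proof. by rewrite msym_subst2 /colour_pol -!colE. Qed.

Definition model_e nu : M := mono id (fun mu => (mu == nu)%:R).
Definition model_x (j : 'I_n.+1) : M := mono id (fun nu => 'X_(col nu j)).
Definition model_t l : M :=
  mono (act (adjtr n l)) (fun nu => half_pol (col nu @@l) (col nu @@l.+1)).

Definition model_gen (g : klr_gen n beta) : M :=
  match g with
  | inl (inl nu) => model_e nu
  | inl (inr j) => model_x j
  | inr l => model_t l
  end.

Definition model_free : klr_free k n beta -> M :=
  free_map (algc : {rmorphism k -> M}) model_gen.

Lemma model_free_monoid : monoid_morphism model_free.
Proof. exact/free_map_monoid/algcC. Qed.

HB.instance Definition _ := GRing.isZmodMorphism.Build (klr_free k n beta) M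
  model_free (free_map_zmod _ _).
HB.instance Definition _ := GRing.isMonoidMorphism.Build (klr_free k n beta) M
  model_free model_free_monoid.

Lemma model_free_e nu : model_free (free_e k nu) = model_e nu.
Proof. exact: free_map_gen. Qed.

Lemma model_free_x j : model_free (free_x k beta j) = model_x j.
Proof. exact: free_map_gen. Qed.

Lemma model_free_t l : model_free (free_tau k beta l) = model_t l.
Proof. exact: free_map_gen. Qed.

Lemma model_free_algc c : model_free (algc c) = algc c.
Proof. exact: free_map_algc. Qed.

Lemma xpol_model f : xpol model_x f = mono id (fun nu => msym (col nu) f).
Proof. exact: xpol_mono. Qed.

Lemma mono_eq0 (g : iseq n beta -> iseq n beta) c : c =1 (fun=> 0) ->
  mono g c = 0 :> M.
Proof. by move=> c0; rewrite -(mono0 _ _ g); apply: eq_mono. Qed.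

Lemma model_t_far l l' : (l.+1 < l')%N || (l'.+1 < l)%N ->
  model_t l * model_t l' = model_t l' * model_t l.
Proof.
move=> far; apply: etrans (monoM _ _ _ _) (etrans _ (esym (monoM _ _ _ _))).
apply: eq_mono => nu /=.
  by rewrite -!iseq_actM (adjtr_comm far).
have fixed (a b : 'I_n) (i : 'I_n.+1) : (i = b :> nat \/ i = b.+1 :> nat) ->
    (a.+1 < b)%N || (b.+1 < a)%N -> adjtr n a i = i.
  move=> ib ab; apply/val_inj; rewrite /= adjtrE; split_tests; lia.
have far' : (l'.+1 < l)%N || (l.+1 < l')%N by rewrite orbC.
have f1 : adjtr n l' @@l = @@l by apply: (fixed _ l) far'; left; apply: val_lo.
have f2 : adjtr n l' @@l.+1 = @@l.+1 by apply: (fixed _ l) far'; right; apply: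
  val_hi.
have f3 : adjtr n l @@l' = @@l' by apply: (fixed _ l') far; left; apply: val_lo.
have f4 : adjtr n l @@l'.+1 = @@l'.+1 by apply: (fixed _ l') far; right; apply:
  val_hi.
rewrite !colour_act_adj f1 f2 f3 f4; exact: mulrC.
Qed.

Lemma model_t_braid l l' : l' = l.+1 :> nat ->
  model_t l' * model_t l * model_t l' = model_t l * model_t l' * model_t l.
Proof.
move=> ll'; apply: etrans (monoMM _ _ _ _ _ _) (etrans _ (esym (monoMM _ _ _ _
  _ _))).
apply: eq_mono => nu /=.
  by rewrite -!iseq_actM !mulgA (adjtr_braid ll').
rewrite !colour_act_adj.
have lo' : @@l' = @@l.+1 by rewrite ll'.
have hi_l : adjtr n l @@l'.+1 = @@l'.+1.
  by apply/val_inj; rewrite /= adjtrE val_hi; split_tests; lia.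
have lo_l' : adjtr n l' @@l = @@l.
  by apply/val_inj; rewrite /= adjtrE val_lo; split_tests; lia.
have lo_l : adjtr n l @@l = @@l.+1 by exact: adjtr_lo.
have hi_l' : adjtr n l' @@l'.+1 = @@l.+1 by rewrite adjtr_hi lo'.
have mid_l : adjtr n l @@l.+1 = @@l by exact: adjtr_hi.
have mid_l' : adjtr n l' @@l.+1 = @@l'.+1 by rewrite -lo' adjtr_lo.
rewrite lo'.
rewrite hi_l lo_l' lo_l hi_l' mid_l mid_l' lo_l' hi_l.
do 3!move: (half_pol _ _) => ?; by rewrite -mulrA mulrC [X in X * _]mulrC.
Qed.

Lemma model_freeM (u1 u2 : klr_free k n beta) :
  model_free (u1 * u2) = model_free u1 * model_free u2.
Proof. exact: rmorphM. Qed.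

Lemma model_freeMM (u1 u2 u3 : klr_free k n beta) :
  model_free (u1 * u2 * u3) = model_free u1 * model_free u2 * model_free u3.
Proof. exact: rmorphMM. Qed.

Lemma model_free_comm2 (u1 u2 v1 v2 r : klr_free k n beta) :
  model_free ((u1 * u2 - v1 * v2) * r)
  = (model_free u1 * model_free u2 - model_free v1 * model_free v2) * model_free r.
Proof. exact: rmorph_comm2. Qed.

Lemma model_free_comm3 (u1 u2 u3 v1 v2 v3 r : klr_free k n beta) :
  model_free ((u1 * u2 * u3 - v1 * v2 * v3) * r)
  = (model_free u1 * model_free u2 * model_free u3
     - model_free v1 * model_free v2 * model_free v3) * model_free r.
Proof. exact: rmorph_comm3. Qed.

Lemma model_e_mul nu mu : model_e nu * model_e mu
  = if nu == mu then model_e nu else 0.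
Proof.
apply: etrans (monoM _ _ _ _) _; have [->|nm] := eqVneq nu mu.
  apply: eq_mono => // t /=.
  by case: eqP; rewrite ?mulr1 ?mulr0.
apply: mono_eq0 => t /=.
by case: eqP => [->|]; rewrite ?mul0r // (negPf nm) mulr0.
Qed.

Lemma model_sum_e : \sum_nu model_e nu = 1.
Proof.
rewrite mono_sum mono1; apply: eq_mono => // t.
by rewrite (bigD1 t) //= eqxx big1 ?addr0 // => nu /negPf; rewrite eq_sym => ->.
Qed.

Lemma mono_id_comm (c d : iseq n beta -> {mpoly k[n.+1]}) :
  mono id c * mono id d = mono id d * mono id c :> M.
Proof. by rewrite !monoM; apply: eq_mono => // t; rewrite /= mulrC. Qed.

Lemma model_t_e l nu : model_t l * model_e nu
  = model_e (act (adjtr n l) nu) * model_t l.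
Proof.
apply: etrans (monoM _ _ _ _) (etrans _ (esym (monoM _ _ _ _))).
apply: eq_mono => // t /=; move: (half_pol _ _) => h.
by rewrite (inj_eq (can_inj (@iseq_act_adjtrK _ _ _ l))) mulrC.
Qed.

Lemma model_t_sqr l nu : model_t l * model_t l * model_e nu
  = xpol model_x (subst2 (Q (nu @@l) (nu @@l.+1)) @@l @@l.+1) * model_e nu.
Proof.
rewrite xpol_model; apply: etrans (monoMM _ _ _ _ _ _) (etrans _ (esym (monoM _
  _ _ _))).
apply: eq_mono => t /=; first by rewrite iseq_act_adjtrK.
case: (eqVneq t nu) => [->|_]; last by rewrite !mulr0.
rewrite !mulr1 colour_crossing !colour_act_adj adjtr_lo adjtr_hi.
by rewrite half_polM 1?colour_pol_sym // (inj_eq perm_inj) eq_sym lo_neq_hi.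
Qed.

Lemma model_t_x l j : model_t l * model_x j = model_x (adjtr n l j) * model_t l.
Proof.
apply: etrans (monoM _ _ _ _) (etrans _ (esym (monoM _ _ _ _))).
apply: eq_mono => // t /=; move: (half_pol _ _) => h.
by rewrite colour_act_adj adjtr_involutive mulrC.
Qed.

Lemma model_free_rel (r r' : klr_free k n beta) :
  klr_rel Q r r' -> model_free r = model_free r'.
Proof.
case=> [nu mu||i j|j nu|l nu|l l' far|l nu|l j nu|l l' nu ll' _|l l' nu D ll'
  nu_eq].
- apply: etrans (model_freeM _ _) _; rewrite !model_free_e model_e_mul.
  by case: eqP => _; rewrite ?model_free_e ?rmorph0.
- rewrite rmorph_sum rmorph1 (eq_bigr model_e) => [|nu _]; last exact: model_free_e.
  exact: model_sum_e.
- apply: etrans (model_freeM _ _) (etrans _ (esym (model_freeM _ _))).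
  by rewrite !model_free_x; apply: mono_id_comm.
- apply: etrans (model_freeM _ _) (etrans _ (esym (model_freeM _ _))).
  by rewrite model_free_x model_free_e; apply: mono_id_comm.
- apply: etrans (model_freeM _ _) (etrans _ (esym (model_freeM _ _))).
  by rewrite model_free_t !model_free_e model_t_e.
- apply: etrans (model_freeM _ _) (etrans _ (esym (model_freeM _ _))).
  rewrite (model_free_t l) (model_free_t l'); exact: model_t_far.
- apply: etrans (model_freeMM _ _ _) (etrans _ (esym (model_freeM _ _))).
  have -> : model_free (free_tau k beta l) = model_t l by exact: model_free_t.
  have -> : model_free (free_e k nu) = model_e nu by exact: model_free_e.
  rewrite model_t_sqr; congr (_ * _); apply/esym.
  apply: etrans (xpol_morph _ _ model_free_algc) _; apply: eq_xpol => i.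
  exact: model_free_x.
- have nu_neq : (nu @@l == nu @@l.+1) = false.
    by rewrite (inj_eq (iseq_fun_inj hi colE (nu := nu))) (negPf (lo_neq_hi l)).
  rewrite nu_neq !andbF rmorph0; apply: etrans (model_free_comm2 _ _ _ _ _) _.
  have -> : model_free (free_tau k beta l) = model_t l by exact: model_free_t.
  have -> : model_free (free_x k beta j) = model_x j by exact: model_free_x.
  have -> : model_free (free_x k beta (adjtr n l j)) = model_x (adjtr n l j).
    exact: model_free_x.
  exact: eq_sub_mul0 (model_t_x l j).
- rewrite rmorph0; apply: etrans (model_free_comm3 _ _ _ _ _ _ _) _.
  have -> : model_free (free_tau k beta l) = model_t l by exact: model_free_t.
  have -> : model_free (free_tau k beta l') = model_t l' by exact: model_free_t.
  exact: eq_sub_mul0 (model_t_braid ll').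
have lt_n := ltn_ord l'; rewrite ll' in lt_n.
exfalso; have := congr1 (@nat_of_ord _) (iseq_fun_inj hi colE nu_eq).
by rewrite val_lo inordK //; lia.
Qed.

Lemma model_free_relator u : klr_relator Q u -> model_free u = 0.
Proof.
move=> [r [r' [rr' ->]]]; have -> : model_free (r - r')
  = model_free r - model_free r' by exact: rmorphB.
by rewrite (model_free_rel rr'); apply: subrr.
Qed.

Definition klr_model : klr Q n beta -> M := 
  @quot_map k _ (@klr_relator k gr C Q n beta) _ model_free.

HB.instance Definition _ := GRing.isZmodMorphism.Build (klr Q n beta) M
  klr_model (quot_map_zmod model_free_relator).
HB.instance Definition _ := GRing.isMonoidMorphism.Build (klr Q n beta) M
  klr_model (quot_map_monoid model_free_relator).

Definition klr_model_morphism : {rmorphism klr Q n beta -> M} := klr_model.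

Lemma klr_model_e nu : klr_model_morphism (klr_e Q nu) = model_e nu.
Proof. exact: etrans (quot_mapE model_free_relator _) (model_free_e nu). Qed.

Lemma klr_model_x j : klr_model_morphism (klr_x Q beta j) = model_x j.
Proof. exact: etrans (quot_mapE model_free_relator _) (model_free_x j). Qed.

Lemma klr_model_tau l : klr_model_morphism (klr_tau Q beta l) = model_t l.
Proof. exact: etrans (quot_mapE model_free_relator _) (model_free_t l). Qed.

Lemma klr_model_algc c : klr_model_morphism (algc c) = algc c.
Proof. exact: etrans (quot_mapE model_free_relator _) (model_free_algc c). Qed.

End KLRModel.

(** * The polynomials g *)

Section LeadingTerms.
Variables (k : idomainType) (gr : grading k) (C : cartan_datum).
Variables (Q : klr_datum gr C) (L : weight_lattice C) (a : cyclo_datum gr L).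

(** The grading of the scalars is nonnegative, so the coefficient of u^p v^q can
only be nonzero when (alpha_i, alpha_i) p + (alpha_j, alpha_j) q is at most
-2 (alpha_i, alpha_j). *)
Lemma klr_Q_support (i j : C) (m : 'X_{1..2}) : i != j -> m \in msupp (Q i j) ->
  (m ord0 <= `|cartan i j|)%N /\
  (m ord0 = `|cartan i j|%N -> m = (U_(ord0) *+ `|cartan i j|)%MM).
Proof.
move=> ij mQ; have := klr_Q_deg Q ij m; rewrite /root_form !cartan_diag.
have c_le0 := cartan_le0 ij; have di := cartan_d_gt0 i; have dj := cartan_d_gt0 j.
have m0 : (Q i j)@_m != 0 by rewrite -mcoeff_msupp.
set dg := (_ - _ - _ : int) => deg_m.
have dg_ge0 : 0 <= dg.
  by case: dg deg_m => //= p E; rewrite E eqxx in m0.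
have le_m0 : (m ord0 <= `|cartan i j|)%N.
  by rewrite -lez_nat; move: dg_ge0; rewrite /dg; nia.
split=> // m0E; apply/mnmP => t; rewrite mnmUnE.
have -> : m ord_max = 0%N -> m t = ((ord0 == t) * `|cartan i j|)%N.
  move=> m1; case: (unliftP ord0 t) => [s ->|->]; last by rewrite eqxx mul1n.
  have -> : lift ord0 s = ord_max by apply/val_inj; rewrite /= (ord1 s).
  by rewrite m1.
  by [].
by move: dg_ge0; rewrite /dg; nia.
Qed.

Lemma subst2_lead n (i j : C) (s t : 'I_n) : i != j -> (s < t)%N ->
  unit_lead t `|cartan i j| (subst2 (Q i j) t s).
Proof.
move=> ij st; set N := `|cartan i j|%N; set m0 := (U_(ord0) *+ N)%MM : 'X_{1..2}.
have [_ [c' _ cc']] := klr_Q_unit Q ij.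
have Uc : (Q i j)@_m0 \is a GRing.unit by apply/unitrPr; exists c'.
have m0Q : m0 \in msupp (Q i j).
  by rewrite mcoeff_msupp; apply: contraTneq Uc => ->; rewrite unitr0.
rewrite subst2E (bigD1_seq m0) ?msupp_uniq //=.
rewrite mnmUnE eqxx mul1n mnmUnE /= mul0n expr0 mulr1.
exists (Q i j)@_m0, (\sum_(m <- msupp (Q i j) | m != m0)
  (Q i j)@_m *: ('X_t ^+ m ord0 * 'X_s ^+ m ord_max)); split=> //.
  by rewrite mpolyXn.
rewrite big_seq_cond; apply: supp_in_sum => m /andP[mQ mm0]; apply: supp_inZ.
have [le_m eq_m] := klr_Q_support ij mQ.
have lt_m : (m ord0 < N)%N.
  by rewrite ltn_neqAle le_m andbT; apply: contraNneq mm0 => /eq_m ->.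
rewrite !mpolyXn -mpolyXD; apply: supp_inX; split.
  rewrite mnmDE !mnmUnE eqxx mul1n (_ : (s == t) = false) ?mul0n ?addn0 //.
  by rewrite -val_eqE /= ltn_eqF.
move=> r tr; rewrite mnmDE !mnmUnE.
have -> : (t == r) = false by rewrite -val_eqE /= ltn_eqF.
by have -> : (s == r) = false by rewrite -val_eqE /= ltn_eqF // (ltn_trans st).
Qed.

Definition cyclo_var n (i : C) (t : 'I_n) : {mpoly k[n]} :=
  (map_poly (@mpolyC n k) (a i)).['X_t].

Lemma cyclo_varE n i (t : 'I_n) : 0 <= simple_coroot i L ->
  cyclo_var i t = 'X_t ^+ `|simple_coroot i L|
    + \sum_(j < `|simple_coroot i L|) (a i)`_j *: 'X_t ^+ j.
Proof.
move=> L_ge0; have sz : size (a i) = `|simple_coroot i L|.+1.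
  by have := cyclo_size a i; lia.
rewrite /cyclo_var horner_coef.
rewrite (size_map_inj_poly (can_inj (@mpolyCK _ _)) (mpolyC0 _ _)).
rewrite sz big_ord_recr /= addrC coef_map /=; congr (_ + _).
  have := cyclo_monic a i; rewrite monicE /lead_coef sz /= => /eqP ->.
  by rewrite mpolyC1 mul1r.
by apply: eq_bigr => j _; rewrite coef_map /= mul_mpolyC.
Qed.

Lemma cyclo_var_lead n i (t : 'I_n) : 0 <= simple_coroot i L ->
  unit_lead t `|simple_coroot i L| (cyclo_var i t).
Proof.
move=> L_ge0; rewrite cyclo_varE //; exists 1; eexists; split; first exact: unitr1.
  by rewrite scale1r -mpolyXn.
apply: supp_in_sum => j _; apply: supp_inZ; rewrite mpolyXn; apply: supp_inX.
split=> [|s ts]; rewrite mnmUnE ?eqxx ?mul1n //.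
by rewrite -val_eqE /= ltn_eqF.
Qed.

Lemma msym_cyclo_var n (w : 'S_n) i (t : 'I_n) :
  0 <= simple_coroot i L -> msym w (cyclo_var i t) = cyclo_var i (w t).
Proof.
have sX c : msym w 'X_c = 'X_(w c) :> {mpoly k[n]} by rewrite /msym mmapX mmap1U.
move=> L_ge0; rewrite !cyclo_varE // rmorphD rmorphXn /= sX; congr (_ + _).
by rewrite raddf_sum; apply: eq_bigr => j _; rewrite /= msymZ rmorphXn /= sX.
Qed.

End LeadingTerms.

Section BuildingPolynomials.
Variables (k : idomainType) (gr : grading k) (C : cartan_datum).
Variables (Q : klr_datum gr C) (L : weight_lattice C) (hL : dominant L).
Variables (a : cyclo_datum gr L) (n : nat).
Variables (i_ : 'I_n.+1 -> C) (hi : injective i_).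
Variables (beta : weight_lattice C) (col : iseq n beta -> 'S_n.+1).
Hypothesis colE : forall (nu : iseq n beta) t, nu t = i_ (col nu t).
Implicit Types (nu mu : iseq n beta) (w v : 'S_n.+1) (l : 'I_n).
Local Notation "@@ l" := (inord l : 'I_n.+1) (at level 8, format "@@ l").

Lemma precE w nu v mu (s t : 'I_n.+1) : iseq_act v mu = iseq_act w nu ->
  prec w nu (mu s) (mu t) = (v s < v t)%N.
Proof.
move=> vw; rewrite /prec -vw; apply/existsP/idP => [[p /existsP[r]]|st].
  rewrite !iseq_actE => /and3P[/eqP/(iseq_fun_inj hi colE) <-].
  by move=> /eqP/(iseq_fun_inj hi colE) <-; rewrite !permKV.
by exists (v s); apply/existsP; exists (v t); rewrite !iseq_actE !permK !eqxx.
Qed.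

(** Unfolding the recursion moves the colour at position t to the front, past
all colours before it; those that stay before it in w.nu contribute Q. *)
Lemma gpol_recE w nu (j : nat) v mu (t : 'I_n.+1) :
    iseq_act v mu = iseq_act w nu -> t = j :> nat ->
  gpol_rec Q a w nu j mu = cyclo_var a (mu t) t
    * \prod_(l < n.+1 | (l < t)%N && (v l < v t)%N) subst2 (Q (mu l) (mu t)) l t.
Proof.
elim: j v mu t => [|j IH] v mu t vw tj.
  have -> : t = ord0 by apply/val_inj.
  by rewrite big1 ?mulr1 // => l /andP[].
have lt_jn : (j < n)%N by rewrite -ltnS -tj.
pose l : 'I_n := Ordinal lt_jn; pose s := adjtr n l.
have tE : t = @@l.+1 by apply/val_inj; rewrite [RHS](val_hi l).
have lo : (inord j : 'I_n.+1) = j :> nat := val_lo l.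
have IHl := IH (s * v)%g (iseq_act s mu) @@l _ (val_lo l).
have smu r : iseq_act s mu r = mu (s r) by rewrite iseq_actE adjtrV.
have -> : gpol_rec Q a w nu j.+1 mu =
    msym s (gpol_rec Q a w nu j (iseq_act s mu))
    * (if prec w nu (mu @@l) (mu @@l.+1) then subst2 (Q (mu @@l) (mu @@l.+1))
      @@l @@l.+1 else 1).
  by rewrite /=; case: ifP; rewrite ?mulr1.
rewrite IHl; last by rewrite -iseq_actM mulgA adjtrK mul1g.
rewrite (precE _ _ vw) msymM msym_cyclo_var // smu adjtr_lo -tE -mulrA;
  congr (_ * _).
rewrite rmorph_prod /=.
rewrite [RHS](bigID (fun r : 'I_n.+1 => r == @@l)) /= mulrC; congr (_ * _).
  have lt_lt : (@@l < t)%N by rewrite /= lo tj.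
  case: ifP => vlt; last by rewrite big1 // => r /andP[/andP[_ vr] /eqP E];
    rewrite E vlt in vr.
  by rewrite (big_pred1 @@l) // => r /=; case: eqP => [->|];
    rewrite ?andbF // lt_lt vlt.
apply: eq_big => r /=.
  rewrite !permM adjtr_lo -tE -val_eqE /= lo tj.
  case: (ltngtP r j) => rj /=; rewrite ?andbF //.
    have -> : (r < j.+1)%N by lia.
    have -> : s r = r by apply/val_inj; rewrite [LHS](adjtrE l) /=;
      split_tests; lia.
    by rewrite andbT.
  by have -> : (r < j.+1)%N = false by lia.
have sj : s (inord j) = t by rewrite tE; apply: adjtr_lo.
move=> /andP[rl _]; rewrite msym_subst2 !smu sj.
have -> // : s r = r.
apply/val_inj; rewrite [LHS](adjtrE l) /=; move: rl; rewrite /= lo;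
  split_tests; lia.
Qed.

Lemma gpolE w nu j : gpol Q a w nu j = cyclo_var a (nu j) j
  * \prod_(l < n.+1 | (l < j)%N && (w l < w j)%N) subst2 (Q (nu l) (nu j)) l j.
Proof. exact: gpol_recE. Qed.

(** The bound as a natural number; the Cartan integers in it are nonpositive. *)
Definition exp_boundn w nu j : nat := (`|simple_coroot (nu j) L|
  + \sum_(l < n.+1 | (l < j)%N && (w l < w j)%N) `|cartan (nu j) (nu l)|)%N.

Lemma exp_boundE w nu j : exp_bound L w nu j = (exp_boundn w nu j)%:Z.
Proof.
rewrite /exp_bound /exp_boundn PoszD gez0_abs //; congr (_ + _).
rewrite -sumrN [RHS](big_morph Posz PoszD (erefl _)); apply: eq_bigr =>
  l /andP[lj _].
rewrite lez0_abs // cartan_le0 // (iseq_fun_neq hi colE) //.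
by rewrite -val_eqE /= gtn_eqF.
Qed.

Lemma gpol_lead w nu j : unit_lead j (exp_boundn w nu j) (gpol Q a w nu j).
Proof.
rewrite gpolE; apply: unit_leadM; first exact: cyclo_var_lead.
apply: unit_lead_prod => l /andP[lj _]; rewrite klr_Q_sym subst2_swap.
by apply: subst2_lead => //; rewrite (iseq_fun_neq hi colE) // -val_eqE /= gtn_eqF.
Qed.

Lemma colour_pol_neq0 (c d : 'I_n.+1) : c != d -> colour_pol Q i_ c d != 0.
Proof.
wlog dc : c d / (d < c)%N => [H|cd].
  move=> cd; case: (ltngtP d c) => [dc|dc|/val_inj E]; first exact: H.
    by rewrite colour_pol_sym H // eq_sym.
  by rewrite E eqxx in cd.
by apply: unit_lead_neq0; apply: subst2_lead => //; rewrite (inj_eq hi).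
Qed.

Lemma model_coef_neq0 mu nu : model_coef Q i_ col mu nu != 0.
Proof.
apply/prodf_neq0 => -[c d] /= /and3P[_ p1 p2]; apply: colour_pol_neq0.
by apply: contraTneq p1 => E; move: p2; rewrite E /precedes ltnn.
Qed.

(** The polynomial g with variables attached to colours. It is symmetric in the
two arrangements, which makes the left and right ideal properties alike. *)
Definition colour_gpol mu nu (c : 'I_n.+1) : {mpoly k[n.+1]} :=
  cyclo_var a (i_ c) c * \prod_(d | precedes (position col mu) d c
    && precedes (position col nu) d c) colour_pol Q i_ d c.

Lemma msym_gpol w nu j :
  msym (col nu) (gpol Q a w nu j) = colour_gpol (iseq_act w nu) nu (col nu j).
Proof.
rewrite gpolE msymM msym_cyclo_var // colE /colour_gpol; congr (_ * _).
rewrite rmorph_prod /= [RHS](reindex_perm (col nu)) /=.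
apply: eq_big => l.
  by rewrite /precedes (position_act hi colE) !permM /position !permK andbC.
by move=> _; rewrite msym_subst2 !colE.
Qed.

End BuildingPolynomials.

(** * The cyclotomic ideal *)

Section CyclotomicIdeal.
Variables (k : idomainType) (gr : grading k) (C : cartan_datum).
Variables (Q : klr_datum gr C) (L : weight_lattice C) (hL : dominant L).
Variables (a : cyclo_datum gr L) (n : nat).
Variables (i_ : 'I_n.+1 -> C) (hi : injective i_).
Variables (beta : weight_lattice C) (col : iseq n beta -> 'S_n.+1).
Hypothesis colE : forall (nu : iseq n beta) t, nu t = i_ (col nu t).
Variables (R : pzAlgType k) (S : @distinct_klr k gr C Q n beta R).
Variables (red : 'S_n.+1 -> seq 'I_n) (hred : forall w, reduced_expr w (red w)).
Local Notation M := (pol_matrix k n.+1 (iseq n beta)).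
Local Notation pos := (position col).
Local Notation act := (@iseq_act C n beta).
Local Notation coef := (model_coef Q i_ col).
Local Notation T := (tau_perm S red).
Local Notation term := (klr_term S red).
Local Notation comb := (klr_comb S red).
Variable phi : {rmorphism R -> M}.
Hypothesis phi_e : forall nu, phi (dklr_e S nu) = model_e k nu.
Hypothesis phi_x : forall j, phi (dklr_x S j) = model_x k col j.
Hypothesis phi_t : forall l, phi (dklr_tau S l) = model_t Q i_ col l.
Hypothesis phi_algc : forall c, phi (algc c) = algc c.
Implicit Types (nu mu : iseq n beta) (w v : 'S_n.+1) (l : 'I_n).
Implicit Types (f g : {mpoly k[n.+1]}) (X Y : M).
Implicit Type F : iseq n beta -> 'S_n.+1 -> {mpoly k[n.+1]}.
Local Notation "@@ l" := (inord l : 'I_n.+1) (at level 8, format "@@ l").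

Definition entry X mu nu : {mpoly k[n.+1]} := X (enum_rank mu) (enum_rank nu).

Lemma model_coef_id nu : coef nu nu = 1.
Proof.
rewrite /model_coef /crossing big1 // => p /and3P[_ p1 p2].
by move: p1; rewrite /precedes ltnNge ltnW.
Qed.

Lemma model_coef_ascent w l nu : ascent w l ->
  coef (act (adjtr n l) (act w nu)) (act w nu) * coef (act w nu) nu
  = coef (act (adjtr n l) (act w nu)) nu.
Proof.
move=> asc; rewrite /model_coef crossing_cocycle; last exact: colour_pol_sym.
by rewrite !(position_act hi colE) crossing_ascent // mul1r.
Qed.

Lemma phi_tau_word s : reduced s -> phi (tau_word S s)
  = mono (act (word_perm s)) (fun nu => coef (act (word_perm s) nu) nu).
Proof.
rewrite /tau_word; elim: s => [_|l s IH].
  rewrite big_nil rmorph1 mono1; apply: eq_mono => nu.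
    by rewrite word_perm0 iseq_act1.
  by rewrite word_perm0 iseq_act1 model_coef_id.
rewrite reduced_cons big_cons rmorphM phi_t => /andP[/IH -> asc].
apply: etrans (monoM _ _ _ _) _; apply: eq_mono => nu /=.
  by rewrite word_perm_cons iseq_actM.
rewrite word_perm_cons iseq_actM -(model_coef_adj Q hi colE).
exact: model_coef_ascent.
Qed.

Lemma phi_T w : phi (T w) = mono (act w) (fun nu => coef (act w nu) nu).
Proof.
have [red_w w_red] := reduced_exprP (hred w).
by have := phi_tau_word red_w; rewrite w_red.
Qed.

Lemma phi_xpol f : phi (xpol (dklr_x S) f) = mono id (fun nu => msym (col nu) f).
Proof.
rewrite (xpol_morph _ _ phi_algc) -xpol_model; apply: eq_xpol => j.
exact: phi_x.
Qed.

Lemma phi_term nu w f : phi (term nu w f)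
  = mono (act w) (fun mu => coef (act w mu) mu * msym (col mu) f * (mu == nu)%:R).
Proof.
rewrite /klr_term !rmorphM phi_T phi_xpol phi_e.
exact: monoMM.
Qed.

Lemma entryD X Y mu nu : entry (X + Y) mu nu = entry X mu nu + entry Y mu nu.
Proof. exact: mxE. Qed.

Lemma entry0 mu nu : entry 0 mu nu = 0.
Proof. exact: mxE. Qed.

Lemma entry_sum (I : Type) (s : seq I) (X : I -> M) mu nu :
  entry (\sum_(i <- s) X i) mu nu = \sum_(i <- s) entry (X i) mu nu.
Proof.
elim: s => [|i s IH]; first by rewrite !big_nil entry0.
by rewrite !big_cons entryD IH.
Qed.

Lemma phi_term_entry nu w f mu nu' : entry (phi (term nu w f)) mu nu'
  = if (nu' == nu) && (mu == act w nu) then coef mu nu' * msym (col nu') f else 0.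
Proof.
rewrite phi_term /entry monoE; have [->|_] /= := eqVneq nu' nu; first by case:
  eqP => // ->; rewrite mulr1.
by rewrite mulr0; case: ifP.
Qed.

Lemma phi_comb_entry F w nu : entry (phi (comb F)) (act w nu) nu
  = coef (act w nu) nu * msym (col nu) (F nu w).
Proof.
rewrite rmorph_sum entry_sum (bigD1 nu) //= [X in _ + X]big1 ?addr0.
  rewrite rmorph_sum entry_sum (bigD1 w) //= [X in _ + X]big1 ?addr0.
    by rewrite phi_term_entry !eqxx.
  move=> v vw; rewrite phi_term_entry eqxx; case: eqP =>
    //= /(iseq_act_free hi colE) E.
  by rewrite E eqxx in vw.
move=> mu mu_nu; rewrite rmorph_sum entry_sum big1 // => v _.
by rewrite phi_term_entry eq_sym (negPf mu_nu).
Qed.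

(** The entries in different positions do not interfere, and their factors
model_coef are not zero. *)
Lemma klr_comb_eq0 F : comb F = 0 -> forall nu w, F nu w = 0.
Proof.
move=> F0 nu w; have := phi_comb_entry F w nu; rewrite F0 rmorph0 entry0 =>
  /esym/eqP.
rewrite mulf_eq0 (negPf (model_coef_neq0 Q hi col _ _)) //= => /eqP.
by rewrite -[X in _ = X](msym0 _ (col nu)) => /inj_msym.
Qed.

Definition cyclo_element : R := \sum_nu xpol (dklr_x S) (cyclo_at a nu) *
  dklr_e S nu.
Definition cyclo_id : R -> Prop := ideal_gen (fun u => u = cyclo_element).

Lemma cyclo_element_e nu :
  cyclo_element * dklr_e S nu = xpol (dklr_x S) (cyclo_at a nu) * dklr_e S nu.
Proof.
rewrite /cyclo_element mulr_suml (bigD1 nu) //= big1 ?addr0 => [|mu mu_nu].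
  by rewrite -mulrA (dklr_eM S) eqxx.
by rewrite -mulrA (dklr_eM S) (negPf mu_nu) mulr0.
Qed.

Lemma cyclo_id_element : cyclo_id cyclo_element.
Proof.
rewrite -[cyclo_element]mul1r -[1 * _]mulr1 -[_ * 1]addr0.
by apply: ideal_genD => //; apply: ideal_gen0.
Qed.

(** Follow the recursion that defines g: multiply by tau_l on the right. If the
strands have crossed in v, then tau_l merges into T v; if not, a square of
tau_l appears, and this is the factor Q in the recursion. *)
Lemma tau_gpol_rec_ideal w nu (j : nat) : (j <= n)%N ->
  forall v mu, act v mu = act w nu ->
  cyclo_id (T v * xpol (dklr_x S) (gpol_rec Q a w nu j mu) * dklr_e S mu).
Proof.
elim: j => [_|j IH lt_jn] v mu vw.
  by rewrite /= -mulrA -cyclo_element_e;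
    apply/ideal_genMl/ideal_genMr/cyclo_id_element.
pose l : 'I_n := Ordinal lt_jn; set g := gpol_rec Q a w nu j (act (adjtr n l) mu).
have IHl : cyclo_id (T (adjtr n l * v)%g * xpol (dklr_x S) g * dklr_e S (act
  (adjtr n l) mu)).
  by apply: (IH (ltnW lt_jn)); rewrite -iseq_actM mulgA adjtrK mul1g.
have {IHl} : cyclo_id (T (adjtr n l * v)%g * dklr_tau S l
    * xpol (dklr_x S) (msym (adjtr n l) g) * dklr_e S mu).
  have := ideal_genMr (dklr_tau S l) IHl;
    rewrite -[_ * _ * dklr_tau S l]mulrA -(dklr_tau_e S).
  rewrite -!mulrA [xpol _ g * (_ * _)]mulrA.
  have -> : xpol (dklr_x S) g * dklr_tau S l
    = dklr_tau S l * xpol (dklr_x S) (msym (adjtr n l) g).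
    by rewrite klr_tau_xpol -msymMm adjtrK msym1m.
  by rewrite -mulrA.
have -> : gpol_rec Q a w nu j.+1 mu = msym (adjtr n l) g
    * (if prec w nu (mu @@l) (mu @@l.+1) then crossing_pol Q l mu else 1).
  by rewrite /=; case: ifP; rewrite ?mulr1.
rewrite (precE hi colE _ _ vw); case: ifP => [vlt|/negbT vge].
  rewrite -(tau_perm_ascent_r S hred vlt) -!mulrA [dklr_tau S l * (_ * _)]mulrA.
  rewrite klr_xpol_e [dklr_tau S l * dklr_tau S l * _]mulrA (dklr_tau_sqr S)
    -[X in T v * X]mulrA -klr_xpol_e.
  by rewrite [xpol _ _ * (_ * _)]mulrA -klr_xpolM [crossing_pol _ _ _ * _]mulrC.
rewrite mulr1 tau_perm_ascent_r //; first by rewrite mulgA adjtrK mul1g.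
rewrite !permM adjtr_lo adjtr_hi ltnNge; move: vge; rewrite -leqNgt leq_eqVlt.
rewrite val_eqE (inj_eq perm_inj) eq_sym (negPf (lo_neq_hi l)) /= => vgt.
by rewrite -ltnNge.
Qed.

Lemma tau_gpol_ideal w nu j f : cyclo_id (term nu w (f * gpol Q a w nu j)).
Proof.
rewrite /klr_term mulrC klr_xpolM -!mulrA klr_xpol_e !mulrA.
by apply/ideal_genMr/tau_gpol_rec_ideal; rewrite // -ltnS.
Qed.

(** Divisibility conditions for the images of R and of the cyclotomic ideal: for
the latter, the cofactor of model_coef at (mu, nu) lies in the ideal of
colour_gpol mu nu. *)
Definition in_order X : Prop := forall mu nu, exists f, entry X mu nu
  = coef mu nu * f.

Local Notation G := (colour_gpol Q a i_ col).

Definition in_ideal X : Prop := forall mu nu, exists h : 'I_n.+1 -> {mpoly k[n.+1]},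
  entry X mu nu = coef mu nu * \sum_c h c * G mu nu c.

Lemma phi_in_order (u : R) : in_order (phi u).
Proof.
have [F ->] := klr_span S hred u; move=> mu nu.
pose P x := exists f, x = coef mu nu * f.
have P0 : P 0 by exists 0; rewrite mulr0.
have PD x y : P x -> P y -> P (x + y).
  by move=> [f ->] [g ->]; exists (f + g); rewrite mulrDr.
rewrite rmorph_sum entry_sum; apply: (big_ind P P0 PD) => mu' _.
rewrite rmorph_sum entry_sum; apply: (big_ind P P0 PD) => w _.
by rewrite phi_term_entry; case: ifP => _; [eexists | exact: P0].
Qed.

Lemma in_ideal0 : in_ideal 0.
Proof.
move=> mu nu; exists (fun=> 0); rewrite entry0 big1 ?mulr0 // => c _; exact: mul0r.
Qed.

Lemma in_idealD X Y : in_ideal X -> in_ideal Y -> in_ideal (X + Y).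
Proof.
move=> XI YI mu nu; have [h hE] := XI mu nu; have [g gE] := YI mu nu.
exists (fun c => h c + g c); rewrite entryD hE gE -mulrDr -big_split; congr (_ * _).
by apply: eq_bigr => c _; rewrite mulrDl.
Qed.

Lemma coef_cocycle la mu nu : coef la mu * coef mu nu
  = crossing (colour_pol Q i_) (pos la) (pos mu) (pos nu) * coef la nu.
Proof. exact/crossing_cocycle/colour_pol_sym. Qed.

Lemma colour_gpolE mu nu c : G mu nu c
  = cyclo_var a (i_ c) c * common_left (colour_pol Q i_) (pos mu) (pos nu) c.
Proof. by []. Qed.

Lemma in_ideal_sum (I : Type) (s : seq I) (x : I -> {mpoly k[n.+1]}) mu nu :
  (forall i, exists h : 'I_n.+1 -> {mpoly k[n.+1]},
    x i = coef mu nu * \sum_c h c * G mu nu c) ->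
  exists h : 'I_n.+1 -> {mpoly k[n.+1]},
    \sum_(i <- s) x i = coef mu nu * \sum_c h c * G mu nu c.
Proof.
move=> H; elim: s => [|i s [h hE]].
  by exists (fun=> 0); rewrite big_nil big1 ?mulr0 // => c _; exact: mul0r.
have [g gE] := H i; exists (fun c => g c + h c).
rewrite big_cons hE gE -mulrDr -big_split; congr (_ * _).
by apply: eq_bigr => c _; rewrite mulrDl.
Qed.

Lemma colour_gpol_crossing_l la mu nu c : exists r,
  crossing (colour_pol Q i_) (pos la) (pos mu) (pos nu) * G mu nu c = r * G la nu c.
Proof.
have [r E] := crossing_common_left (colour_pol Q i_) (pos la) (pos mu) (pos nu) c.
by exists r; rewrite !colour_gpolE mulrCA E mulrCA.
Qed.

Lemma colour_gpolC mu nu c : G mu nu c = G nu mu c.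
Proof. by rewrite !colour_gpolE common_leftC. Qed.

Lemma colour_gpol_crossing_r la mu nu c : exists r,
  crossing (colour_pol Q i_) (pos la) (pos mu) (pos nu) * G la mu c = r * G la nu c.
Proof.
have [r E] := colour_gpol_crossing_l nu mu la c.
by exists r; rewrite crossing_swap (colour_gpolC la mu) E (colour_gpolC nu la).
Qed.

Lemma ideal_scale (x f : {mpoly k[n.+1]}) (g h g' : 'I_n.+1 -> {mpoly k[n.+1]}) :
  (forall c, exists r, x * g c = r * g' c) ->
  exists h', x * (f * \sum_c h c * g c) = \sum_c h' c * g' c.
Proof.
move=> /fin_all_exists[r rE]; exists (fun c => f * h c * r c).
rewrite mulrCA !mulr_sumr; apply: eq_bigr => c _.
by rewrite [x * (h c * _)]mulrCA rE !mulrA.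
Qed.

(** The cocycle rule leaves a factor crossing, and this factor turns the
generators at (mu, nu) into multiples of the generators at (la, nu). *)
Lemma in_idealMl X Y : in_order X -> in_ideal Y -> in_ideal (X * Y).
Proof.
move=> XO YI la nu; rewrite /entry mulE; apply: in_ideal_sum => mu.
have [f fE] := XO la mu; have [h hE] := YI mu nu.
rewrite [X _ _]fE [Y _ _]hE mulrACA coef_cocycle [crossing _ _ _ _ * _]mulrC -mulrA.
have [h' ->] := ideal_scale f h (colour_gpol_crossing_l la mu nu).
by exists h'.
Qed.

Lemma in_idealMr X Y : in_ideal X -> in_order Y -> in_ideal (X * Y).
Proof.
move=> XI YO la nu; rewrite /entry mulE; apply: in_ideal_sum => mu.
have [f fE] := YO mu nu; have [h hE] := XI la mu.
rewrite [X _ _]hE [Y _ _]fE mulrACA coef_cocycle [crossing _ _ _ _ * _]mulrC -mulrA.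
rewrite [(\sum_c _) * f]mulrC.
have [h' ->] := ideal_scale f h (colour_gpol_crossing_r la mu nu).
by exists h'.
Qed.

Lemma in_ideal_cyclo_element : in_ideal (phi cyclo_element).
Proof.
have -> : cyclo_element = comb (fun nu w => if w == 1%g then cyclo_at a nu else 0).
  apply: eq_bigr => nu _; rewrite (bigD1 1%g) //= big1 ?addr0 => [|w /negPf ->].
    by rewrite eqxx /klr_term tau_perm1 // mul1r.
  exact: klr_term0.
rewrite rmorph_sum => mu nu; rewrite entry_sum; apply: in_ideal_sum => nu'.
rewrite rmorph_sum entry_sum; apply: in_ideal_sum => w.
rewrite phi_term_entry; case: ifP => [/andP[/eqP <- /eqP ->]|_]; last first.
  by exists (fun=> 0); rewrite big1 ?mulr0 // => c _; exact: mul0r.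
case: eqP => [->|_]; last first.
  by rewrite msym0; exists (fun=> 0); rewrite big1 // => c _; exact: mul0r.
exists (fun c => (c == col nu ord0)%:R); congr (_ * _).
rewrite (bigD1 (col nu ord0)) //= eqxx mul1r big1 ?addr0; last first.
  by move=> c /negPf ->; rewrite mul0r.
have -> : cyclo_at a nu = gpol Q a 1 nu ord0 by [].
by rewrite (msym_gpol Q hL a hi colE).
Qed.

Lemma phi_ideal (u : R) : cyclo_id u -> in_ideal (phi u).
Proof.
elim=> [|u1 r u2 v -> _ IH]; first by rewrite rmorph0; apply: in_ideal0.
rewrite rmorphD !rmorphM; apply: in_idealD => //.
apply: in_idealMr (phi_in_order u2).
by apply: in_idealMl in_ideal_cyclo_element; apply: phi_in_order.
Qed.

(** Cancelling the nonzero factor model_coef in the entries gives one direction,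
tau_gpol_ideal the other: the cyclotomic ideal is a direct sum of ideals of the
polynomial ring along the basis T_w e(nu). *)
Lemma cyclo_id_combP F : cyclo_id (comb F) <->
  forall nu w, exists h : 'I_n.+1 -> {mpoly k[n.+1]},
    F nu w = \sum_j h j * gpol Q a w nu j.
Proof.
split=> [/phi_ideal FI nu w|FE].
  have [h] := FI (act w nu) nu; rewrite phi_comb_entry.
  move=> /(mulfI (model_coef_neq0 Q hi col _ _)) hE.
  exists (fun j => msym (col nu)^-1 (h (col nu j))); apply: (inj_msym (col nu)).
  rewrite hE raddf_sum (reindex_perm (col nu)) /=; apply: eq_bigr => j _.
  by rewrite msymM -msymMm mulVg msym1m (msym_gpol Q hL a hi colE).
have I0 : cyclo_id 0 := ideal_gen0 _.
apply: (big_ind cyclo_id I0 (@ideal_genDr _ R _)) => nu _.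
apply: (big_ind cyclo_id I0 (@ideal_genDr _ R _)) => w _.
have [h ->] := FE nu w; elim/big_rec: _ => [|j f _ IH].
  by rewrite klr_term0; apply: ideal_gen0.
by rewrite klr_termD; apply: ideal_genDr => //; apply: tau_gpol_ideal.
Qed.

End CyclotomicIdeal.

(** * Bases *)

Section MonomialFamilies.
Variables (k : idomainType) (n : nat) (K : finType) (R : pzAlgType k).
Variable t : K -> {mpoly k[n]} -> R.
Hypothesis tD : forall i f g, t i (f + g) = t i f + t i g.
Hypothesis tZ : forall i c f, t i (c *: f) = algc c * t i f.
Implicit Types (s : seq (K * 'X_{1..n})) (c : K * 'X_{1..n} -> k).

Definition collect s c (i : K) : {mpoly k[n]} :=
  \sum_(j <- s | j.1 == i) c j *: 'X_[j.2].

Lemma collect_coef s c j : uniq s -> j \in s -> (collect s c j.1)@_j.2 = c j.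
Proof.
move=> us js; rewrite /collect -big_filter raddf_sum /=.
rewrite (bigD1_seq j) ?filter_uniq ?mem_filter ?eqxx //= mcoeffZ mcoeffX eqxx mulr1.
rewrite big1_seq ?addr0 // => i /andP[ij]; rewrite mem_filter => /andP[/eqP ij1 _].
rewrite mcoeffZ mcoeffX; case: eqP => [ij2|_]; last by rewrite mulr0.
by case: i j ij1 ij2 ij {js} => [i1 i2] [j1 j2] /= -> ->; rewrite eqxx.
Qed.

Lemma collect_supp (P : K -> 'X_{1..n} -> Prop) s c i :
  (forall j, j \in s -> P j.1 j.2) -> supp_in (P i) (collect s c i).
Proof.
move=> sP; rewrite /collect big_seq_cond; apply: supp_in_sum => j /andP[js /eqP <-].
by apply: supp_inZ; apply: supp_inX; apply: sP.
Qed.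

Lemma family0 i : t i 0 = 0.
Proof. by have := tZ i 0 0; rewrite scale0r rmorph0 mul0r. Qed.

Lemma family_sum i (I : Type) (s : seq I) (f : I -> {mpoly k[n]}) :
  t i (\sum_(j <- s) f j) = \sum_(j <- s) t i (f j).
Proof. exact: (big_morph _ (tD i) (family0 i)). Qed.

Lemma sum_collect s c :
  \sum_(j <- s) algc (c j) * t j.1 'X_[j.2] = \sum_i t i (collect s c i).
Proof.
have E i : t i (collect s c i) = \sum_(j <- s | j.1 == i) algc (c j) * t i 'X_[j.2].
  rewrite (big_morph _ (tD i) (family0 i)); apply: eq_bigr => j _; exact: tZ.
under [RHS]eq_bigr => i _ do rewrite E.
rewrite (exchange_big_dep predT) //=; apply: eq_bigr => j _.
by rewrite (big_pred1 j.1) // => i; rewrite eq_sym.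
Qed.

Definition expansion (p : K -> {mpoly k[n]}) : seq (K * 'X_{1..n}) :=
  [seq (i, m) | i <- index_enum K, m <- msupp (p i)].

Lemma expansionP p j : j \in expansion p -> j.2 \in msupp (p j.1).
Proof. by case/allpairsPdep => i [m [_ mp ->]]. Qed.

Lemma sum_expansion p : \sum_i t i (p i)
  = \sum_(j <- expansion p) algc (p j.1)@_j.2 * t j.1 'X_[j.2].
Proof.
rewrite big_allpairs_dep; apply: eq_bigr => i _.
by rewrite {1}(mpolyE (p i)) family_sum; apply: eq_bigr => m _; rewrite tZ.
Qed.

End MonomialFamilies.

Section Bases.
Variables (k : idomainType) (gr : grading k) (C : cartan_datum).
Variables (Q : klr_datum gr C) (L : weight_lattice C) (hL : dominant L).
Variables (a : cyclo_datum gr L) (n : nat).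
Variables (i_ : 'I_n.+1 -> C) (hi : injective i_).
Variables (beta : weight_lattice C) (col : iseq n beta -> 'S_n.+1).
Hypothesis colE : forall (nu : iseq n beta) t, nu t = i_ (col nu t).
Variables (R : pzAlgType k) (S : @distinct_klr k gr C Q n beta R).
Variables (red : 'S_n.+1 -> seq 'I_n) (hred : forall w, reduced_expr w (red w)).
Variable phi : {rmorphism R -> pol_matrix k n.+1 (iseq n beta)}.
Hypothesis phi_e : forall nu, phi (dklr_e S nu) = model_e k nu.
Hypothesis phi_x : forall j, phi (dklr_x S j) = model_x k col j.
Hypothesis phi_t : forall l, phi (dklr_tau S l) = model_t Q i_ col l.
Hypothesis phi_algc : forall c, phi (algc c) = algc c.
Local Notation term := (klr_term S red).
Local Notation comb := (klr_comb S red).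
Local Notation bexp := (exp_boundn L).
Local Notation K1 := (iseq n beta * 'S_n.+1)%type.
Local Notation K2 := (iseq n beta * 'S_n.+1 * 'I_n.+1)%type.
Local Notation gp := (gpol Q a).
Local Notation IdealE := (cyclo_id_combP hL a hi colE hred phi_e phi_x phi_t
  phi_algc).
Local Notation Comb0 := (klr_comb_eq0 hi colE hred phi_e phi_x phi_t phi_algc).

(** The families of the two bases are indexed by pairs of an index i and a
monomial; for fixed i they extend linearly to all polynomials. *)
Definition quot_term (i : K1) f : R := term i.1 i.2 f.
Definition ideal_term (i : K2) f : R := term i.1.1 i.1.2 (f * gp i.1.2 i.1.1 i.2).

Lemma quot_term_mon nu w m : quot_term (nu, w) 'X_[m]
  = tau_perm S red w * xmon (dklr_x S) m * dklr_e S nu.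
Proof. by rewrite /quot_term /klr_term xpol_mon. Qed.

Lemma ideal_term_mon nu w j m : ideal_term (nu, w, j) 'X_[m]
  = tau_perm S red w * xmon (dklr_x S) m * xpol (dklr_x S) (gp w nu j) * dklr_e
    S nu.
Proof. by rewrite /ideal_term /klr_term klr_xpolM xpol_mon !mulrA. Qed.

Lemma quot_termD i f g : quot_term i (f + g) = quot_term i f + quot_term i g.
Proof. exact: klr_termD. Qed.

Lemma quot_termZ i c f : quot_term i (c *: f) = algc c * quot_term i f.
Proof. exact: klr_termZ. Qed.

Lemma ideal_termD i f g : ideal_term i (f + g) = ideal_term i f + ideal_term i g.
Proof. by rewrite /ideal_term mulrDl klr_termD. Qed.

Lemma ideal_termZ i c f : ideal_term i (c *: f) = algc c * ideal_term i f.
Proof. by rewrite /ideal_term -scalerAl klr_termZ. Qed.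

Lemma comb_sum (F : iseq n beta -> 'S_n.+1 -> {mpoly k[n.+1]}) :
  comb F = \sum_(i : K1) quot_term i (F i.1 i.2).
Proof. by rewrite /klr_comb pair_big. Qed.

Lemma ideal_term_sum (p : K2 -> {mpoly k[n.+1]}) : \sum_i ideal_term i (p i)
  = comb (fun nu w => \sum_j p (nu, w, j) * gp w nu j).
Proof.
rewrite comb_sum; transitivity (\sum_(i : K1) \sum_j ideal_term (i, j) (p (i, j))).
  by rewrite pair_big; apply: eq_bigr => -[].
by apply: eq_bigr => -[nu w] _; rewrite (family_sum quot_termD quot_termZ).
Qed.

Let lead w nu j := gpol_lead Q hL a hi colE w nu j.

Lemma quot_span (u : R) : exists (s : seq (K1 * 'X_{1..n.+1})) (c : _ -> k),
  (forall j, j \in s -> bounded_from (bexp j.1.2 j.1.1) 0 j.2) /\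
  cyclo_id a S (u - \sum_(j <- s) algc (c j) * quot_term j.1 'X_[j.2]).
Proof.
have [F ->] := klr_span S hred u.
have /fin_all_exists[r rP] (i : K1) : exists r,
  supp_in (bounded_from (bexp i.2 i.1) 0) r
    /\ exists h : 'I_n.+1 -> {mpoly k[n.+1]}, F i.1 i.2 - r
      = \sum_j h j * gp i.2 i.1 j.
  have [q [r [-> qP rP]]] := normal_form (lead i.2 i.1) (F i.1 i.2).
  by exists r; split=> //; exists q; rewrite addrK.
exists (expansion r), (fun j => (r j.1)@_j.2); split=> [j /expansionP|].
  exact: (rP j.1).1.
rewrite -(sum_expansion quot_termD quot_termZ).
have -> : \sum_i quot_term i (r i) = comb (fun nu w => r (nu, w)).
  by rewrite comb_sum; apply: eq_bigr => -[nu w].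
by rewrite -klr_combB; apply/IdealE => nu w; exact: (rP (nu, w)).2.
Qed.

Lemma quot_free (s : seq (K1 * 'X_{1..n.+1})) (c : _ -> k) : uniq s ->
  (forall j, j \in s -> bounded_from (bexp j.1.2 j.1.1) 0 j.2) ->
  cyclo_id a S (\sum_(j <- s) algc (c j) * quot_term j.1 'X_[j.2]) ->
  forall j, j \in s -> c j = 0.
Proof.
move=> us sP; rewrite (sum_collect quot_termD quot_termZ).
have -> : \sum_i quot_term i (collect s c i) = comb (fun nu w =>
  collect s c (nu, w)).
  by rewrite comb_sum; apply: eq_bigr => -[nu w].
move=> /IdealE IF j js; rewrite -(collect_coef c us js).
have {}IF := IF j.1.1 j.1.2; rewrite -surjective_pairing in IF.
have [h hE] := IF.
pose P (i : K1) := bounded_from (bexp i.2 i.1) 0.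
have := @collect_supp _ _ _ P s c j.1 sP.
by rewrite hE => /(ideal_normal_eq0 (lead _ _)) ->; rewrite mcoeff0.
Qed.

Lemma ideal_term_in i f : cyclo_id a S (ideal_term i f).
Proof. exact: (tau_gpol_ideal a hi colE). Qed.

Lemma ideal_span (u : R) : cyclo_id a S u ->
  exists (s : seq (K2 * 'X_{1..n.+1})) (c : _ -> k),
  (forall j, j \in s -> bounded_from (bexp j.1.1.2 j.1.1.1) j.1.2.+1 j.2) /\
  u = \sum_(j <- s) algc (c j) * ideal_term j.1 'X_[j.2].
Proof.
have [F ->] := klr_span S hred u => /IdealE IF.
have /fin_all_exists[q qP] (i : K1) : exists q : 'I_n.+1 -> {mpoly k[n.+1]},
    F i.1 i.2 = \sum_j q j * gp i.2 i.1 j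
    /\ forall j : 'I_n.+1, supp_in (bounded_from (bexp i.2 i.1) j.+1) (q j).
  have [h ->] := IF i.1 i.2; exact: ideal_normal_form (lead i.2 i.1) h.
pose p (i : K2) := q i.1 i.2.
exists (expansion p), (fun j => (p j.1)@_j.2); split=> [j /expansionP|].
  exact: (qP j.1.1).2.
rewrite -(sum_expansion ideal_termD ideal_termZ) ideal_term_sum.
by apply: eq_bigr => nu _; apply: eq_bigr => w _; rewrite (qP (nu, w)).1.
Qed.

Lemma ideal_free (s : seq (K2 * 'X_{1..n.+1})) (c : _ -> k) : uniq s ->
  (forall j, j \in s -> bounded_from (bexp j.1.1.2 j.1.1.1) j.1.2.+1 j.2) ->
  \sum_(j <- s) algc (c j) * ideal_term j.1 'X_[j.2] = 0 ->
  forall j, j \in s -> c j = 0.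
Proof.
move=> us sP; rewrite (sum_collect ideal_termD ideal_termZ) ideal_term_sum.
move=> /Comb0 F0 j js; rewrite -(collect_coef c us js).
have {}F0 := F0 j.1.1.1 j.1.1.2.
have -> : collect s c j.1 = collect s c (j.1.1.1, j.1.1.2, j.1.2) by case:
  (j.1) => [[]].
pose q t := collect s c (j.1.1.1, j.1.1.2, t).
suff q0 : forall t, q t = 0 by rewrite -/(q j.1.2) q0 mcoeff0.
apply: (normal_form_uniq (lead j.1.1.2 j.1.1.1) (r := 0)) => [|t|];
  first by rewrite addr0.
  pose P (i : K2) := bounded_from (bexp i.1.2 i.1.1) i.2.+1.
  exact: (@collect_supp _ _ _ P s c (j.1.1.1, j.1.1.2, t) sP).
exact: supp_in0.
Qed.

End Bases.

Theorem corollary3p11 (C : cartan_datum) (k : idomainType) (gr : grading k)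
    (Q : klr_datum gr C) (L : weight_lattice C) (hL : dominant L)
    (a : cyclo_datum gr L) (n : nat) (i_ : 'I_n.+1 -> C) (hi : injective i_)
    (beta : weight_lattice C) (hbeta : beta = \sum_t simple_root (i_ t))
    (red : 'S_n.+1 -> seq 'I_n) (hred : forall w, reduced_expr w (red w)) :
  is_basis
    (fun '((nu, w, m) : iseq n beta * 'S_n.+1 * 'X_{1..n.+1}) =>
       forall t : 'I_n.+1, (m t)%:Z < exp_bound L w nu t)
    (fun '((nu, w, m) : iseq n beta * 'S_n.+1 * 'X_{1..n.+1}) =>
       to_cyclo a
         (klr_tau_word Q beta (red w) * xmon (klr_x Q beta) m * klr_e Q nu))
    (fun _ : cyclo_klr Q n beta a => True)
  /\
  is_basis
    (fun '((nu, w, j, m) :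
           iseq n beta * 'S_n.+1 * 'I_n.+1 * 'X_{1..n.+1}) =>
       forall t : 'I_n.+1, (j < t)%N -> (m t)%:Z < exp_bound L w nu t)
    (fun '((nu, w, j, m) :
           iseq n beta * 'S_n.+1 * 'I_n.+1 * 'X_{1..n.+1}) =>
       klr_tau_word Q beta (red w) * xmon (klr_x Q beta) m
       * xpol (klr_x Q beta) (gpol Q a w nu j) * klr_e Q nu)
    (cyclo_ideal (Q := Q) (n := n) (beta := beta) a).
Proof.
have [col colE] := iseq_colour_map hi hbeta.
pose S := klr_distinct Q hi colE.
pose phi := klr_model_morphism Q hi colE.
have phi_e : forall nu, phi (dklr_e S nu) = model_e k nu := klr_model_e Q hi colE.
have phi_x : forall j, phi (dklr_x S j) = model_x k col j := klr_model_x Q hi colE.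
have phi_t : forall l, phi (dklr_tau S l)
  = model_t Q i_ col l := klr_model_tau Q hi colE.
have phi_algc : forall c, phi (algc c) = algc c := klr_model_algc Q hi colE.
have boundE (m : 'X_{1..n.+1}) w (nu : iseq n beta) t :
    ((m t)%:Z < exp_bound L w nu t) = (m t < exp_boundn L w nu t)%N.
  by rewrite (exp_boundE hL hi colE) ltz_nat.
have quot_termE (c : _ -> k) (s : seq (iseq n beta * 'S_n.+1 * 'X_{1..n.+1})) :
    \sum_(j <- s) c j *: (let '(nu, w, m) := j in to_cyclo a
         (klr_tau_word Q beta (red w) * xmon (klr_x Q beta) m * klr_e Q nu))
    = to_cyclo a (\sum_(j <- s) algc (c j) * quot_term S red j.1 'X_[j.2]).
  rewrite [RHS]to_quot_sumZ; apply: eq_bigr => -[[nu w] m] _.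
  by rewrite quot_term_mon.
have ideal_termE (c : _ -> k) (s :
  seq (iseq n beta * 'S_n.+1 * 'I_n.+1 * 'X_{1..n.+1})) :
    \sum_(j <- s) c j *: (let '(nu, w, j, m) := j in
       klr_tau_word Q beta (red w) * xmon (klr_x Q beta) m
       * xpol (klr_x Q beta) (gpol Q a w nu j) * klr_e Q nu)
    = \sum_(j <- s) algc (c j) * ideal_term a S red j.1 'X_[j.2].
  by apply: eq_bigr => -[[[nu w] j] m] _; rewrite ideal_term_mon.
split; split.
- by [].
- move=> v _; have [u ->] := to_quot_surj v.
  have [s [c [sP uE]]] := quot_span hL a hi colE hred phi_e phi_x phi_t phi_algc u.
  exists s, c; split=> [[[nu w] m] /sP H t|]; first by rewrite boundE; apply: H.
  by rewrite quot_termE; apply/to_quotP.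
- move=> s c us sD; rewrite quot_termE => /to_quot_eq0.
  apply: (quot_free hL hi colE hred phi_e phi_x phi_t phi_algc us).
  by move=> [[nu w] m] /sD H t _; rewrite -boundE; apply: H.
- move=> [[[nu w] j] m] _.
  have := ideal_term_in a hi colE S hred (nu, w, j) 'X_[m].
  by rewrite ideal_term_mon.
- move=> u /(ideal_span hL hi colE hred phi_e phi_x phi_t phi_algc)[s [c [sP ->]]].
  exists s, c; split; last exact/esym/ideal_termE.
  by move=> [[[nu w] j] m] /sP H t jt; rewrite boundE; apply: H.
move=> s c us sD; rewrite ideal_termE.
apply: (ideal_free hL hi colE hred phi_e phi_x phi_t phi_algc us).
by move=> [[[nu w] j] m] /sD H t jt; rewrite -boundE; apply: H.
Qed.
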